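(* Let $\lambda=(p,0,r;a,1/2;x)\in\mathcal{I}$ be a non-elementary solution to Problem I, and let $s:=r/p$ (an integer $\ge2$). If $s=2$ then $x$ is an algebraic number of degree $2$. If $s\ge3$ then the degree of $x$ as an algebraic number satisfies $$\deg x>\delta(s):=\frac{(\log p_s)(s-1)}{1+\log(s-1)},$$ where $p_s$ is the least prime factor of $s-1$. In particular, for any bound $D$, only finitely many values of $s$ occur among non-elementary solutions with $\deg x\le D$.
   Context: For $\lambda=(p,q,r;a,b;x)\in\mathbb{R}^6$ with $0<x<1$ put $f(w;\lambda):={}_2F_1(pw+a,\,qw+b;\,rw;\,x)$ (Gauss hypergeometric function, meromorphic in $w\in\mathbb{C}$). $\lambda$ is a solution to Problem I if there are $C,d\in\mathbb{C}^\times$, $u_i,v_j\in\mathbb{C}$ with $f(w;\lambda)=C\,d^w\prod_{i=1}^m\Gamma(w+u_i)/\prod_{j=1}^n\Gamma(w+v_j)$ identically in $w$. $\lambda$ is elementary if $f(w;\lambda)$ has finitely many poles in $w$. $\mathcal{I}:=\{(p,0,r;a,b;x)\in\mathbb{R}^6:0<p<r,\ 0<x<1\}$. It is known that non-elementary solutions in $\mathcal{I}$ have $p,r\in\mathbb{Z}$ and $b=1/2$, and (by the paper's main theorem) that $r/p$ is an integer $\ge2$ for them. *)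

(* Defs.v *)
From Stdlib Require Import Reals ZArith Znumtheory List.
From Coquelicot Require Import Coquelicot.
Open Scope R_scope.

Definition Cexp (z : C) : C :=
  (exp (Re z) * cos (Im z), exp (Re z) * sin (Im z)).

(* Limit of a complex sequence (componentwise; meaningful when it converges). *)
Definition Clim (u : nat -> C) : C :=
  (real (Lim_seq (fun n => Re (u n))), real (Lim_seq (fun n => Im (u n)))).

Definition CSeries (a : nat -> C) : C :=
  Clim (fun N => fold_right Cplus (RtoC 0) (map a (seq 0 (S N)))).

Fixpoint poch (al : C) (n : nat) : C :=
  match n with
  | O => RtoC 1
  | S k => Cmult (poch al k) (Cplus al (RtoC (INR k)))
  end.

Definition hyp2F1 (al be ga : C) (x : R) : C :=
  CSeries (fun n => Cmult (Cdiv (Cmult (poch al n) (poch be n))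
                                 (Cmult (poch ga n) (RtoC (INR (fact n)))))
                          (RtoC (x ^ n))).

(* Reciprocal Gamma function (entire), via Gauss' product formula:
   1/Gamma(z) = lim_n z(z+1)...(z+n) / (n! n^z). *)
Definition rGamma (z : C) : C :=
  Clim (fun n => Cdiv (poch z (S n))
                      (Cmult (RtoC (INR (fact n))) (Cexp (Cmult z (RtoC (ln (INR n))))))).

(* Gamma function (used only away from its poles). *)
Definition Gamma (z : C) : C := Cinv (rGamma z).

Definition nonpos_int (z : C) : Prop := exists k : nat, z = RtoC (- INR k).

Definition Cprod (l : list C) : C := fold_right Cmult (RtoC 1) l.

Definition fhyp (p q r a b x : R) (w : C) : C :=
  hyp2F1 (Cplus (Cmult (RtoC p) w) (RtoC a)) (Cplus (Cmult (RtoC q) w) (RtoC b))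
         (Cmult (RtoC r) w) x.

Definition fdom (r : R) (w : C) : Prop := ~ nonpos_int (Cmult (RtoC r) w).

(* lambda solves Problem I: f(w) = C d^w prod Gamma(w+u_i) / prod Gamma(w+v_j)
   identically (as meromorphic functions).  d^w is written exp(L w) with
   d = exp L (any branch).  Equality is required at every w where the series
   defines f and no Gamma(w+u_i) has a pole; 1/Gamma(w+v_j) = rGamma(w+v_j). *)
Definition problemI_solution (p q r a b x : R) : Prop :=
  exists (C0 L : C) (us vs : list C),
    C0 <> RtoC 0 /\
    forall w : C, fdom r w ->
      List.Forall (fun u => ~ nonpos_int (Cplus w u)) us ->
      fhyp p q r a b x w =
        Cmult (Cmult (Cmult C0 (Cexp (Cmult L w)))
                     (Cprod (map (fun u => Gamma (Cplus w u)) us)))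
              (Cprod (map (fun v => rGamma (Cplus w v)) vs)).

Definition is_pole (p q r a b x : R) (w0 : C) : Prop :=
  forall M : R, exists d : R, 0 < d /\
    forall w : C, w <> w0 -> Cmod (Cminus w w0) < d -> fdom r w ->
      M < Cmod (fhyp p q r a b x w).

Definition elementary (p q r a b x : R) : Prop :=
  exists l : list C, forall w0, is_pole p q r a b x w0 -> In w0 l.

Definition in_I (p q r a b x : R) : Prop :=
  q = 0 /\ 0 < p /\ p < r /\ 0 < x /\ x < 1.

Definition poly_eval (c : nat -> Z) (n : nat) (x : R) : R :=
  sum_f_R0 (fun k => IZR (c k) * x ^ k) n.

Definition alg_degree (x : R) (n : nat) : Prop :=
  (exists c : nat -> Z, c n <> 0%Z /\ poly_eval c n x = 0) /\
  (forall (m : nat) (c : nat -> Z), c m <> 0%Z -> poly_eval c m x = 0 -> (n <= m)%nat).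

Definition least_prime_factor (ps m : nat) : Prop :=
  prime (Z.of_nat ps) /\ (Z.of_nat ps | Z.of_nat m)%Z /\
  forall q : nat, prime (Z.of_nat q) -> (Z.of_nat q | Z.of_nat m)%Z -> (ps <= q)%nat.

Definition delta (ps s : nat) : R :=
  ln (INR ps) * INR (s - 1) / (1 + ln (INR (s - 1))).

(* Main.v *)
Require Import Defs.
From mathcomp Require all_boot all_order all_algebra.
From mathcomp Require complex zify ssrZ Rstruct ring.

(** On the real axis a gamma product formula for [f] gives [V(w) f(w+1) = e^L U(w) f(w)] with
    [U = prod (w + u_i)] and [V = prod (w + v_j)].  Since [f] stays in [[1, 1/(1-x)]] as
    [w -> +oo], [deg U = deg V] and [|e^L| = 1], so [|U/V| -> 1] as [w -> -oo] too.  Hence the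
    residues of [f] at [w = -k/r] have consecutive ratios (step [r] in [k]) tending to [1] in
    absolute value, which also forces [r] to be an integer.  These residues are explicit, and up
    to a polynomial factor they grow like a geometric sequence, whose ratio must be [1]:
    [(s-1)^(s-1) x^s = s^s (1-x)^(s-1)].  For [s = 2] this is a quadratic equation for [x].

    With [N = s-1] and [z = N x / (s (1-x))] it reads [z^s = s z + N].  Let [g] be an integral
    factor of [T^s - s T - N] having the root [z > 1].  All roots [t] satisfy [|t| <= z]; at most
    one lies in the open unit disc, it is simple, and there [|t| z > 1].  So [g(0)], a divisor of
    [N], has [1 < |g(0)| <= z^(deg g)], whence [p_s <= z^(deg x)], while
    [N log z < 1 + log N]. *)

(** * Roots of the trinomial *)

Module TrinomialRoots.

Import all_boot all_order all_algebra complex zify ssrZ Rstruct ring.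
Import Order.TTheory GRing.Theory Num.Theory.

Local Open Scope ring_scope.

(** The argument stays on the real axis and keeps only absolute values: the complex data [L], [u_i],
    [v_j] survive as |e^L|, |U|, |V|, and |e^L U/V| has the same limit at both ends of the axis. At
    the left end no bound on f is at hand, so the recurrence is multiplied by the linear factor that
    vanishes at a pole and passed to the limit there. Two step lengths must be reconciled: the
    recurrence moves k by r, while k/s, which enters the first parameter, changes by an integer only
    when s divides the step. Residues are therefore compared at distance r s, and the critical
    equation appears raised to the power r. A residue also contains the rest of the series, again
    hypergeometric with large parameters; it is only sandwiched between binomial series up to a
    factor linear in k, which suffices because a limit of ratios ignores polynomial factors. On the
    algebraic side strictness is delicate: 1 < |g(0)| rests on |t| z > 1, which degenerates to an
    equality for s = 2 (roots 1 + sqrt 2 and 1 - sqrt 2). For s >= 3 it follows from z > 1 + 2/s. *)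

Definition trinomial (N : nat) : {poly int} := 'X^(N.+1) - N.+1%:R *: 'X - N%:R%:P.

Lemma trinomial_monic N : (0 < N)%N -> trinomial N \is monic.
Proof.
move=> N0; rewrite monicE /trinomial -addrA -opprD lead_coefDl ?lead_coefXn //.
rewrite size_polyN size_polyXn ltnS (leq_trans (size_polyD _ _)) // geq_max.
rewrite (leq_trans (size_scale_leq _ _)) ?size_polyX //.
by rewrite (leq_trans (size_polyC_leq1 _)).
Qed.

Lemma horner_trinomial (F : comNzRingType) N (t : F) :
  (map_poly intr (trinomial N)).[t] = t ^+ N.+1 - N.+1%:R * t - N%:R.
Proof.
by rewrite /trinomial !rmorphB /= map_polyXn map_polyZ map_polyX map_polyC /= !hornerE !rmorph_nat.
Qed.

Section Modulus.
Variables (K : numClosedFieldType) (N : nat) (z : K).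
Hypothesis N0 : (0 < N)%N.
Hypothesis z_gt1 : 1 < z.
Hypothesis z_root : z ^+ N.+1 = N.+1%:R * z + N%:R.
Hypothesis z_inv : z^-1 ^+ N.+1 + N.+1%:R * z^-1 < N%:R.

Let tri_root (t : K) := t ^+ N.+1 = N.+1%:R * t + N%:R.
Let z0 : 0 < z. Proof. exact: lt_trans z_gt1. Qed.

(** The function y (y^N - (N+1)) is increasing where y^N > N+1, which holds from y = z on, and it
    equals N at z. The triangle inequality keeps it at most N at y = |t|. *)
Lemma norm_root_le t : tri_root t -> `|t| <= z.
Proof.
move=> rt.
rewrite real_leNgt ?normr_real ?gtr0_real //; apply/negP => ltzt.
have le1 : `|t| ^+ N.+1 <= N.+1%:R * `|t| + N%:R.
  by rewrite -normrX rt (le_trans (ler_normD _ _)) // normrM !normr_nat.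
have zN : N.+1%:R < z ^+ N.
  by rewrite -(ltr_pM2r z0) -exprSr z_root ltrDl ltr0n.
have leN : z ^+ N <= `|t| ^+ N by rewrite lerXn2r ?nnegrE ?normr_ge0 ?ltW.
have : z * (z ^+ N - N.+1%:R) < `|t| * (`|t| ^+ N - N.+1%:R).
  apply: (@lt_le_trans _ _ (`|t| * (z ^+ N - N.+1%:R))).
    by rewrite ltr_pM2r // subr_gt0.
  by rewrite ler_pM2l ?(lt_trans z0) // lerB.
rewrite !mulrBr -!exprS z_root [z * _]mulrC addrAC subrr add0r => ltN.
have /(lt_le_trans ltN) : `|t| ^+ N.+1 - `|t| * N.+1%:R <= N%:R by rewrite lerBlDl mulrC.
by rewrite ltxx.
Qed.

(** A root with |t| <= 1/z would give N = |t^(N+1) - (N+1) t| <= z^-(N+1) + (N+1)/z, against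
    [z_inv]. For N = 1 the two roots satisfy z |t| = 1, so [z_inv] encodes a genuine restriction on
    N. *)
Lemma norm_small_root t : tri_root t -> 1 < z * `|t|.
Proof.
move=> rt; rewrite mulrC -ltr_pdivrMr // div1r.
rewrite real_ltNge ?normr_real ?gtr0_real ?invr_gt0 //; apply/negP => le_tz.
have /le_lt_trans/(_ z_inv) : N%:R <= z^-1 ^+ N.+1 + N.+1%:R * z^-1.
  rewrite -(normr_nat K N).
  have -> : N%:R = t ^+ N.+1 - N.+1%:R * t by rewrite rt addrAC subrr add0r.
  rewrite (le_trans (ler_normB _ _)) // normrX normrM normr_nat lerD //.
    by rewrite lerXn2r ?nnegrE ?invr_ge0 ?normr_ge0 // ltW.
  by rewrite ler_pM2l // ltr0n.
by rewrite ltxx.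
Qed.

(** Dividing the difference of the two equations by t - u leaves a sum of N+1 monomials equal to
    N+1; each has norm at most 1, and t^N has norm less than 1. *)
Lemma small_root_uniq t u : tri_root t -> tri_root u -> `|t| < 1 -> `|u| < 1 -> t = u.
Proof.
move=> rt ru t1 u1; apply/eqP; rewrite -subr_eq0; apply/negPn/negP => tu0.
have : t ^+ N.+1 - u ^+ N.+1 = (t - u) * N.+1%:R by rewrite rt ru; ring.
rewrite subrXX => /(mulfI tu0) /(congr1 Num.norm); rewrite normr_nat => sumE.
have : `|\sum_(i < N.+1) t ^+ (N.+1.-1 - i) * u ^+ i| < N.+1%:R.
  rewrite big_ord_recl /= (le_lt_trans (ler_normD _ _)) // -natr1 addrC ler_ltD //.
    rewrite (le_trans (ler_norm_sum _ _ _)) //.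
    have -> : N%:R = \sum_(i < N) 1 :> K by rewrite sumr_const card_ord.
    by apply: ler_sum => i _; rewrite normrM !normrX mulr_ile1 ?exprn_ge0 ?exprn_ile1 // ltW.
  by rewrite subn0 expr0 mulr1 normrX exprn_ilt1 // -lt0n.
by rewrite sumE ltxx.
Qed.

(** The derivative is (N+1)(t^N - 1), whose zeros all lie on the unit circle. *)
Lemma small_root_simple t (q : {poly K}) :
  `|t| < 1 -> map_poly intr (trinomial N) = q * ('X - t%:P) ^+ 2 -> False.
Proof.
move=> t1 /(congr1 (fun p => p^`().[t])).
rewrite derivM deriv_exp derivXsubC !hornerE subrr !(mul0r, mulr0, mul0rn, addr0, add0r, expr0n) /=.
rewrite /trinomial !rmorphB /= map_polyXn map_polyZ map_polyX map_polyC /=.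
rewrite !derivE !hornerE /= !rmorph_nat.
rewrite subrr mulr0 subr0 hornerMn hornerXn => /eqP.
rewrite -[_ *+ _]mulr_natl -[X in _ - X]mulr1 -mulrBr mulf_eq0 pnatr_eq0 /= subr_eq0 => /eqP tN.
have : `|t ^+ N| < 1 by rewrite normrX exprn_ilt1 // -lt0n.
by rewrite tN normr1 ltxx.
Qed.

Lemma prod_norm_le rs : (forall t, t \in rs -> tri_root t) ->
  \prod_(t <- rs) `|t| <= z ^+ size rs.
Proof.
elim: rs => [|t rs IH] Hrs; first by rewrite big_nil expr0.
rewrite big_cons /= exprS ler_pM ?normr_ge0 ?prodr_ge0 //.
- by apply: norm_root_le; apply: Hrs; rewrite mem_head.
- by apply: IH => u u_rs; apply: Hrs; rewrite inE u_rs orbT.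
Qed.

Lemma prod_norm_ge1 (rs : seq K) : (forall t, t \in rs -> 1 <= `|t|) -> 1 <= \prod_(t <- rs) `|t|.
Proof.
elim: rs => [|t rs IH] Hrs; first by rewrite big_nil.
rewrite big_cons mulr_ege1 //; first by apply: Hrs; rewrite mem_head.
by apply: IH => u u_rs; apply: Hrs; rewrite inE u_rs orbT.
Qed.

(** A root inside the unit disc is paired with z, and z |t| > 1; every other factor is at least 1.
    The list records roots with multiplicity, so a second small entry is excluded by uniqueness and
    simplicity together. *)
Lemma prod_norm_gt1 rs (q : {poly K}) :
  map_poly intr (trinomial N) = q * \prod_(t <- rs) ('X - t%:P) -> z \in rs ->
  1 < \prod_(t <- rs) `|t|.
Proof.
move=> PE z_rs.
have Hrs t : t \in rs -> tri_root t.
  move=> t_rs; have : root (map_poly intr (trinomial N)) t.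
    by rewrite PE rootM root_prod_XsubC t_rs orbT.
  by rewrite /root horner_trinomial -addrA -opprD subr_eq0 => /eqP.
have rs_perm := perm_to_rem z_rs; set rs1 := rem z rs in rs_perm.
have Hrs1 t : t \in rs1 -> tri_root t by move/mem_rem; exact: Hrs.
rewrite (perm_big _ rs_perm) big_cons /= (ger0_norm (ltW z0)).
have [/hasP[t t_rs1 t1]|/hasPn big1] := boolP (has (fun t => `|t| < 1) rs1); last first.
  rewrite (lt_le_trans z_gt1) // ler_peMr ?(ltW z0) // prod_norm_ge1 // => t /big1.
  by rewrite -real_leNgt ?normr_real ?real1.
have rs1_perm := perm_to_rem t_rs1; set rs2 := rem t rs1 in rs1_perm.
rewrite (perm_big _ rs1_perm) big_cons /= mulrA.
have zt1 : 1 < z * `|t| by apply: norm_small_root; apply: Hrs1.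
rewrite (lt_le_trans zt1) // ler_peMr ?(ltW (lt_trans ltr01 zt1)) //.
apply: prod_norm_ge1 => u u_rs2.
rewrite real_leNgt ?normr_real ?real1 //; apply/negP => u1.
have ut : u = t by apply: small_root_uniq => //; apply: Hrs1 => //; apply: mem_rem u_rs2.
have rs2_perm := perm_to_rem u_rs2; rewrite ut in rs2_perm.
move: PE; rewrite (perm_big _ rs_perm) big_cons (perm_big _ rs1_perm) big_cons /=.
rewrite (perm_big _ rs2_perm) big_cons /=.
set B := \prod_(_ <- _) _ => PE.
apply: (@small_root_simple t (q * ('X - z%:P) * B)) => //; rewrite PE; ring.
Qed.
End Modulus.

(** A factor of a monic integral polynomial has leading coefficient 1 or -1, so |p1(0)| is exactly
    the product of the norms of its roots. *)
Lemma constant_term_of_factor (K : numClosedFieldType) (N : nat) (z : K) (p1 r1 : {poly int}) :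
  (0 < N)%N -> 1 < z -> z ^+ N.+1 = N.+1%:R * z + N%:R ->
  z^-1 ^+ N.+1 + N.+1%:R * z^-1 < N%:R ->
  trinomial N = p1 * r1 -> root (map_poly intr p1) z ->
  1 < `|(p1.[0])%:~R : K| /\ `|(p1.[0])%:~R : K| <= z ^+ (size p1).-1.
Proof.
move=> N0 z_gt1 z_root z_inv Pp z_p1.
have absE (m : int) : `|m%:~R : K| = (`|m|%N)%:R by rewrite natr_absz intr_norm.
have lc1 : `|(lead_coef p1)%:~R : K| = 1.
  have /monicP := trinomial_monic N N0; rewrite Pp lead_coefM => /(congr1 absz).
  by rewrite abszM => /eqP; rewrite muln_eq1 => /andP[/eqP lc _]; rewrite absE lc.
have lcn0 : (lead_coef p1)%:~R != 0 :> K by rewrite -normr_eq0 lc1 oner_eq0.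
have [rs] := closed_field_poly_normal (map_poly intr p1 : {poly K}).
rewrite lead_coef_map_id0 //; set lc := (lead_coef p1)%:~R => p1E.
have z_rs : z \in rs by move: z_p1; rewrite p1E rootZ // root_prod_XsubC.
have size_rs : (size p1).-1 = size rs.
  by rewrite -(size_map_poly_id0 (f := intr) lcn0) p1E size_scale // size_prod_XsubC.
have PE : map_poly intr (trinomial N) = (lc *: map_poly intr r1) * \prod_(t <- rs) ('X - t%:P) :> {poly K}.
  by rewrite Pp rmorphM /= p1E -scalerAl mulrC scalerAl.
have cE : `|(p1.[0])%:~R : K| = \prod_(t <- rs) `|t|.
  rewrite -[(p1.[0])%:~R]/(intr p1.[0]) -horner_map /= p1E hornerZ normrM lc1 mul1r.
  by rewrite horner_prod normr_prod; apply: eq_bigr => t _; rewrite !hornerE ?sub0r normrN.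
rewrite cE size_rs; split; first exact: (prod_norm_gt1 _ _ _ N0 z_gt1 z_inv _ _ PE z_rs).
apply: (prod_norm_le K N z) => // t t_rs.
have : root (map_poly intr (trinomial N)) t.
  by rewrite PE rootM root_prod_XsubC t_rs orbT.
by rewrite /root horner_trinomial -addrA -opprD subr_eq0 => /eqP.
Qed.

(** Here [g] is an arbitrary integral annihilator of z. Its gcd with the trinomial over the
    rationals still has the root z, and Gauss's lemma ([dvdpP_rat_int]) turns it into an integral
    factor [p1] of no larger degree; the divisor is |p1(0)|. Norms of roots are taken in the
    algebraic closure [R[i]]. *)
Lemma root_constant_divisor (R : rcfType) (N : nat) (z : R) (g : {poly int}) :
  (0 < N)%N -> 1 < z -> z ^+ N.+1 = N.+1%:R * z + N%:R ->
  z^-1 ^+ N.+1 + N.+1%:R * z^-1 < N%:R ->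
  g != 0 -> root (map_poly intr g) z ->
  exists d : nat, [/\ (d %| N)%N, (1 < d)%N & d%:R <= z ^+ (size g).-1].
Proof.
move=> N0 z_gt1 z_root z_inv g0 z_g.
pose toQ := map_poly (intr : int -> rat).
pose d := gcdp (toQ g) (toQ (trinomial N)).
have gQ0 : toQ g != 0 by rewrite map_poly_eq0_id0 // intr_eq0 lead_coef_eq0.
have mapQ (p : {poly int}) : map_poly (ratr : rat -> R) (toQ p) = map_poly intr p.
  by rewrite -map_poly_comp; apply: eq_map_poly => m /=; rewrite ratr_int.
have z_d : root (map_poly (ratr : rat -> R) d) z.
  rewrite gcdp_map root_gcd !mapQ z_g /= /root horner_trinomial z_root.
  by apply/eqP; ring.
have /dvdpP_rat_int[p1 [c c0 dE] [r1 Pp]] : d %| toQ (trinomial N) by apply: dvdp_gcdr.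
have z_p1 : root (map_poly intr p1) z.
  by move: z_d; rewrite dE map_polyZ rootZ ?fmorph_eq0 // mapQ.
have size_p1 : (size p1 <= size g)%N.
  by rewrite -(size_rat_int_poly p1) -(size_scale _ c0) -dE -(size_rat_int_poly g) dvdp_leq // dvdp_gcdl.
pose zC : R[i] := z%:C%C.
have z_p1C : root (map_poly intr p1) zC.
  have -> : map_poly intr p1 = map_poly (real_complex R) (map_poly intr p1).
    by rewrite -map_poly_comp; apply: eq_map_poly => m /=; rewrite rmorph_int.
  by rewrite fmorph_root.
have [] := @constant_term_of_factor R[i] N zC p1 r1 N0 _ _ _ Pp z_p1C.
- by rewrite -[1]/(1%:C%C) ltcR.
- by rewrite /zC -rmorphXn z_root rmorphD rmorphM !rmorph_nat.
- rewrite /zC -fmorphV -rmorphXn -[N.+1%:R](rmorph_nat (real_complex R)) -rmorphM -rmorphD.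
  by rewrite -(rmorph_nat (real_complex R)) ltcR.
have absE (m : int) : `|m%:~R : R[i]| = (`|m|%N)%:R by rewrite natr_absz intr_norm.
rewrite absE ltr1n => d1 dle.
exists `|p1.[0]|%N; split=> //.
  move/(congr1 (fun p => `|p.[0]|%N)): Pp; rewrite hornerM abszM => E.
  have <- : `|(trinomial N).[0]|%N = N.
    by rewrite /trinomial !hornerE expr0n /= ?mulr0 ?subr0 ?sub0r ?oppr0 ?add0r abszN natz.
  by rewrite E dvdn_mulr.
have : `|p1.[0]|%:R <= z ^+ (size p1).-1.
  by rewrite -lecR rmorph_nat rmorphXn.
move=> /le_trans; apply; rewrite ler_weXn2l ?(ltW z_gt1) //.
by case: (size p1) size_p1 => [|n]; case: (size g).
Qed.

(* If [(N + (N+1) t) x = (N+1) t], the value at [t] is [(N + (N+1) t)^n] times the value at [x]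
   of the polynomial with coefficients [e]. *)
Definition mobius_poly (e : nat -> int) (N n : nat) : {poly int} :=
  \sum_(i < n.+1) e i *: ((N.+1%:R *: 'X) ^+ i * (N%:R%:P + N.+1%:R *: 'X) ^+ (n - i)).

Lemma horner_mobius_poly (F : comNzRingType) e N n (t : F) :
  (map_poly intr (mobius_poly e N n)).[t] =
  \sum_(i < n.+1) (e i)%:~R * ((N.+1%:R * t) ^+ i * (N%:R + N.+1%:R * t) ^+ (n - i)).
Proof.
rewrite /mobius_poly rmorph_sum horner_sum; apply: eq_bigr => i _ /=.
rewrite map_polyZ rmorphM !rmorphXn rmorphD /= !map_polyZ map_polyX map_polyC /=.
by rewrite !hornerE !rmorph_nat.
Qed.

Lemma size_mobius_poly e N n : (size (mobius_poly e N n) <= n.+1)%N.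
Proof.
rewrite (leq_trans (size_sum _ _ _)) //; apply/bigmax_leqP => i _.
rewrite (leq_trans (size_scale_leq _ _)) // (leq_trans (size_polyMleq _ _)) //.
have size_lin : (size (N.+1%:R *: 'X : {poly int}) <= 2)%N.
  by rewrite (leq_trans (size_scale_leq _ _)) // size_polyX.
have size_aff : (size (N%:R%:P + N.+1%:R *: 'X : {poly int})%R <= 2)%N.
  by rewrite (leq_trans (size_polyD _ _)) // geq_max size_lin (leq_trans (size_polyC_leq1 _)).
have size_pow (p : {poly int}) k : (size p <= 2)%N -> (size (p ^+ k) <= k.+1)%N.
  move=> p2; rewrite (leq_trans (size_poly_exp_leq _ _)) // ltnS -[leqRHS]mul1n leq_mul2r orbC.
  by case: (size p) p2 => // -[|[]].
have := leq_add (size_pow _ i size_lin) (size_pow _ (n - i)%N size_aff).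
rewrite addSn addnS subnKC; last by rewrite -ltnS.
by case: (_ + _)%N.
Qed.

(** At t = -N/(N+1), the pole of the Moebius map, every summand but the last vanishes, and that one
    is e_n (-N)^n. *)
Lemma mobius_poly_neq0 e N n : (0 < N)%N -> e n != 0 -> mobius_poly e N n != 0.
Proof.
move=> N0 en0; apply/eqP => G0.
have := horner_mobius_poly rat e N n (- N%:R / N.+1%:R).
rewrite G0 rmorph0 horner0 mulrC divfK ?pnatr_eq0 // subrr big_ord_recr /= subnn expr0 mulr1.
rewrite big1 ?add0r => [/esym/eqP|i _]; last first.
  by rewrite expr0n subn_eq0 leqNgt ltn_ord !mulr0.
by rewrite mulf_eq0 intr_eq0 (negPf en0) expf_eq0 oppr_eq0 pnatr_eq0 eqn0Ngt N0 andbF.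
Qed.

(** * Transfer between the numbers of the standard library and those of MathComp *)

Lemma IZR_Z_of_int (k : int) : Rdefinitions.IZR (Z_of_int k) = k%:~R.
Proof.
case: k => n.
  by rewrite -[Z_of_int _]/(BinInt.Z.of_nat n) -RIneq.INR_IZR_INZ INRE.
have -> : Z_of_int (Negz n) = BinInt.Z.opp (BinInt.Z.of_nat n.+1) by lia.
by rewrite RIneq.opp_IZR -RIneq.INR_IZR_INZ INRE NegzE mulrNz.
Qed.

Lemma poly_eval_horner (c : nat -> BinNums.Z) n (x : Rdefinitions.R) :
  poly_eval c n x = (map_poly intr (\poly_(i < n.+1) int_of_Z (c i))).[x].
Proof.
rewrite map_polyE /poly_eval; set q := \poly_(i < n.+1) _.
have -> : (Poly [seq i%:~R | i <- q]).[x] = \sum_(i < n.+1) (int_of_Z (c i))%:~R * x ^+ i.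
  rewrite -map_polyE (horner_coef_wide _ (n := n.+1)); last first.
    by rewrite (leq_trans (size_poly _ _)) // size_poly.
  by apply: eq_bigr => i _; rewrite coef_map /= coef_poly ltn_ord.
rewrite -(big_mkord xpredT (fun i => (int_of_Z (c i))%:~R * x ^+ i)).
elim: n {q} => [|n IH] /=.
  by rewrite big_nat1 -IZR_Z_of_int int_of_ZK.
by rewrite big_nat_recr //= -IH -IZR_Z_of_int int_of_ZK -RpowE.
Qed.

Lemma int_root_poly_eval (q : {poly int}) (x : Rdefinitions.R) :
  q != 0 -> root (map_poly intr q) x ->
  exists n (c : nat -> BinNums.Z), c n <> BinNums.Z0 /\ poly_eval c n x = 0.
Proof.
move=> q0 /rootP qx; exists (size q).-1, (fun i => Z_of_int q`_i); split.
  move/(congr1 int_of_Z); rewrite Z_of_intK; apply/eqP.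
  by rewrite -lead_coefE lead_coef_eq0.
rewrite poly_eval_horner -[RHS]qx; congr (map_poly _ _).[_].
apply/polyP => i; rewrite coef_poly Z_of_intK.
by case: ltnP => //; rewrite prednK ?lt0n ?size_poly_eq0 // => /(nth_default 0) ->.
Qed.

(** This supplies some annihilator of x, from which one of least degree can be chosen. The
    polynomial is nonzero because its value at 0 is -(N+1)^(N+1). *)
Lemma critical_root_algebraic (N : nat) (x : Rdefinitions.R) :
  Rdefinitions.Rmult (Rpow_def.pow (Raxioms.INR N) N) (Rpow_def.pow x N.+1) =
  Rdefinitions.Rmult (Rpow_def.pow (Raxioms.INR N.+1) N.+1)
    (Rpow_def.pow (Rdefinitions.Rminus 1 x) N) ->
  exists n (c : nat -> BinNums.Z), c n <> BinNums.Z0 /\ poly_eval c n x = 0.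
Proof.
rewrite !RpowE !INRE RmultE RmultE RminusE => E.
apply: (int_root_poly_eval ((N%:R ^+ N) *: 'X^(N.+1) - (N.+1%:R ^+ N.+1) *: (1 - 'X) ^+ N)).
  apply/eqP => /(congr1 (horner^~ 0)); rewrite !hornerE expr0n /= ?(mulr0, subr0, oppr0, addr0, expr1n, mulr1, sub0r, add0r).
  by apply/eqP; rewrite oppr_eq0 expf_eq0 pnatr_eq0.
apply/rootP; rewrite rmorphB /= !map_polyZ !rmorphXn /= rmorphB rmorph1 /= !map_polyX.
by rewrite !hornerE /= ?rmorph_nat; apply/eqP; rewrite subr_eq0 -E.
Qed.

(** The relation between x and z is the inverse of z = N x / ((N+1)(1-x)). A Moebius substitution
    thus carries an annihilator of x to one of z without raising the degree, and
    [root_constant_divisor] applies to the latter. *)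
Lemma degree_root_bound (N n : nat) (x z : Rdefinitions.R) (c : nat -> BinNums.Z) :
  (0 < N)%N -> Rdefinitions.Rlt 1 z ->
  Rpow_def.pow z N.+1 = Rdefinitions.Rplus (Rdefinitions.Rmult (Raxioms.INR N.+1) z) (Raxioms.INR N) ->
  Rdefinitions.Rlt (Rdefinitions.Rplus (Rpow_def.pow (Rdefinitions.Rinv z) N.+1)
    (Rdefinitions.Rmult (Raxioms.INR N.+1) (Rdefinitions.Rinv z))) (Raxioms.INR N) ->
  Rdefinitions.Rmult x (Rdefinitions.Rplus (Raxioms.INR N) (Rdefinitions.Rmult (Raxioms.INR N.+1) z)) =
  Rdefinitions.Rmult (Raxioms.INR N.+1) z ->
  c n <> BinNums.Z0 -> poly_eval c n x = 0 ->
  exists d e : nat, [/\ N = Nat.mul d e, (1 < d)%N & Rdefinitions.Rle (Raxioms.INR d) (Rpow_def.pow z n)].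
Proof.
move=> N0 /RltP z1; rewrite !RpowE !INRE RplusE !RmultE => z_root /RltP.
rewrite ?RplusE ?RmultE ?RinvE => z_inv xz cn cx.
pose e i := int_of_Z (c i).
have en0 : e n != 0.
  by apply/eqP => /(congr1 Z_of_int); rewrite int_of_ZK.
pose y := N%:R + N.+1%:R * z.
have [] := @root_constant_divisor _ N z (mobius_poly e N n) N0 z1 z_root z_inv
  (mobius_poly_neq0 e N n N0 en0).
  apply/rootP; rewrite horner_mobius_poly -/y.
  move: cx; rewrite poly_eval_horner (horner_coef_wide _ (n := n.+1)); last first.
    by rewrite (leq_trans (size_poly _ _)) // size_poly.
  move/(congr1 (fun v => v * y ^+ n)); rewrite mul0r mulr_suml => {2}<-.
  apply: eq_bigr => i _; rewrite coef_map /= coef_poly ltn_ord -mulrA; congr (_ * _).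
  rewrite -xz -/y exprMn -mulrA -exprD subnKC //; by rewrite -ltnS.
move=> d [/dvdnP[k Nkd] d1 dz]; exists d, k; split=> //; first by rewrite Nkd mulnC.
apply/RleP; rewrite ?RpowE ?INRE; apply: (le_trans dz); apply: ler_weXn2l; first exact: ltW.
by rewrite -ltnS (leq_trans _ (size_mobius_poly e N n)) // prednK ?lt0n ?size_poly_eq0 ?mobius_poly_neq0.
Qed.

End TrinomialRoots.

From Stdlib Require Import Reals ZArith Znumtheory List Lra Lia.
From Coquelicot Require Import Coquelicot.
Open Scope R_scope.

(** * The functional equation of the gamma function *)

(** [Lim_seq] assigns a value to every sequence, so [Clim] alone says nothing about convergence; the
    limit laws for [rGamma] become available only once this property is established. *)
Definition ex_Clim (u : nat -> C) : Prop :=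
  ex_finite_lim_seq (fun n => Re (u n)) /\ ex_finite_lim_seq (fun n => Im (u n)).

(** The summable majorant of size 1/n^2 used for Gauss's product; it is chosen because its partial
    sums are explicit. *)
Lemma is_series_inv_telescope :
  is_series (fun n => / (INR n + 1) - / (INR n + 2)) 1.
Proof.
  assert (Hs : forall N, sum_f_R0 (fun n => / (INR n + 1) - / (INR n + 2)) N
                         = 1 - / (INR N + 2)).
  { induction N as [|N IH].
    - simpl. field.
    - rewrite tech5, IH, S_INR.
      assert (H := pos_INR N). field. lra. }
  change (is_lim_seq (sum_n (fun n => / (INR n + 1) - / (INR n + 2))) 1).
  apply (is_lim_seq_ext (fun N => 1 - / (INR N + 2))).
  - intros N. now rewrite sum_n_Reals, Hs.
  - replace (Finite 1) with (Finite (1 - 0)) by (f_equal; ring).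
    apply is_lim_seq_minus'; [apply is_lim_seq_const|].
    apply (is_lim_seq_inv _ p_infty); [|discriminate].
    apply (is_lim_seq_plus _ _ p_infty 2); [apply is_lim_seq_INR|apply is_lim_seq_const|reflexivity].
Qed.

Lemma ex_finite_lim_seq_diff (v b : nat -> R) :
  (forall n, Rabs (v (S n) - v n) <= b n) -> ex_series b -> ex_finite_lim_seq v.
Proof.
  intros Hv Hb.
  destruct (ex_series_le (fun n => v (S n) - v n) b Hv Hb) as [l Hl].
  exists (l + v O).
  apply is_lim_seq_incr_1.
  apply (is_lim_seq_ext (fun N => sum_n (fun n => v (S n) - v n) N + v O)).
  - induction n as [|n IH].
    + rewrite sum_O. ring.
    + rewrite sum_Sn. unfold plus; simpl. lra.
  - apply is_lim_seq_plus'; [exact Hl|apply is_lim_seq_const].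
Qed.

Lemma im_le_Cmod (z : C) : Rabs (Im z) <= Cmod z.
Proof.
  eapply Rle_trans; [|apply Rmax_Cmod]. apply Rmax_r.
Qed.

(** Since |rho| <= exp |rho - 1|, the partial products stay below |u_0| exp K; the increments u_n
    (rho_n - 1) are then dominated by a convergent series. *)
Lemma ex_Clim_product (u rho : nat -> C) (K : R) :
  0 <= K ->
  (forall n, u (S n) = Cmult (u n) (rho n)) ->
  (forall n, Cmod (Cminus (rho n) (RtoC 1)) <= K * (/ (INR n + 1) - / (INR n + 2))) ->
  ex_Clim u.
Proof.
  intros HK Hu Hrho.
  assert (Hbd : forall n, Cmod (u n) <= Cmod (u O) * exp (K * (1 - / (INR n + 1)))).
  { induction n as [|n IH].
    - simpl. replace (K * (1 - / (0 + 1))) with 0 by field. rewrite exp_0. lra.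
    - rewrite Hu, Cmod_mult.
      assert (Hr : Cmod (rho n) <= exp (K * (/ (INR n + 1) - / (INR n + 2)))).
      { replace (rho n) with (Cplus (Cminus (rho n) (RtoC 1)) (RtoC 1)) by ring.
        eapply Rle_trans; [apply Cmod_triangle|].
        rewrite Cmod_1. specialize (Hrho n).
        generalize (exp_ineq1_le (K * (/ (INR n + 1) - / (INR n + 2)))). lra. }
      replace (K * (1 - / (INR (S n) + 1)))
        with (K * (1 - / (INR n + 1)) + K * (/ (INR n + 1) - / (INR n + 2)))
        by (rewrite S_INR; assert (H := pos_INR n); field; lra).
      rewrite exp_plus, <- Rmult_assoc.
      apply Rmult_le_compat; auto using Cmod_ge_0. }
  set (B := Cmod (u O) * exp K).
  assert (HB : forall n, Cmod (u n) <= B).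
  { intros n. eapply Rle_trans; [apply Hbd|]. unfold B.
    apply Rmult_le_compat_l; [apply Cmod_ge_0|].
    assert (0 < / (INR n + 1)) by (apply Rinv_0_lt_compat; generalize (pos_INR n); lra).
    destruct (Rle_lt_or_eq_dec _ _ HK) as [HK'|<-].
    - left. apply exp_increasing. nra.
    - rewrite Rmult_0_l. lra. }
  assert (Hd : forall n, Cmod (Cminus (u (S n)) (u n)) <= B * K * (/ (INR n + 1) - / (INR n + 2))).
  { intros n. rewrite Hu.
    replace (Cminus (Cmult (u n) (rho n)) (u n)) with (Cmult (u n) (Cminus (rho n) (RtoC 1))) by ring.
    rewrite Cmod_mult, Rmult_assoc.
    apply Rmult_le_compat; auto using Cmod_ge_0. }
  assert (Hb : ex_series (fun n => B * K * (/ (INR n + 1) - / (INR n + 2)))).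
  { apply (ex_series_scal (V := R_NormedModule) (B * K)
             (fun n => / (INR n + 1) - / (INR n + 2))). exists 1. exact is_series_inv_telescope. }
  split; apply (fun H => ex_finite_lim_seq_diff _ _ H Hb); intros n;
    (eapply Rle_trans; [|apply (Hd n)]).
  - eapply Rle_trans; [|apply re_le_Cmod]. simpl. apply Rle_refl.
  - eapply Rle_trans; [|apply im_le_Cmod]. simpl. apply Rle_refl.
Qed.

Lemma Rabs_sin_le (v : R) : Rabs (sin v) <= Rabs v.
Proof.
  destruct (MVT_gen sin 0 v cos) as [c [_ Hc]].
  - intros; auto_derive; auto; ring.
  - intros; apply continuity_sin.
  - rewrite sin_0, !Rminus_0_r in Hc. rewrite Hc, Rabs_mult.
    assert (H := COS_bound c). assert (Rabs (cos c) <= 1) by (apply Rabs_le; lra).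
    assert (H1 := Rabs_pos v). nra.
Qed.

Lemma MVT_abs_le (v c : R) : Rmin 0 v <= c <= Rmax 0 v -> Rabs c <= Rabs v.
Proof.
  unfold Rmin, Rmax. destruct (Rle_dec 0 v); intros; split_Rabs; lra.
Qed.

Lemma Rabs_cos_sub1 (v : R) : Rabs (cos v - 1) <= Rabs v * Rmin 1 (Rabs v).
Proof.
  destruct (MVT_gen cos 0 v (fun t => - sin t)) as [c [Hcv Hc]].
  - intros; auto_derive; auto; ring.
  - intros; apply continuity_cos.
  - rewrite cos_0, !Rminus_0_r in Hc. rewrite Hc, Rabs_mult, Rabs_Ropp.
    apply MVT_abs_le in Hcv.
    assert (H := SIN_bound c). assert (H2 : Rabs (sin c) <= 1) by (apply Rabs_le; lra).
    assert (H3 := Rabs_sin_le c).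
    rewrite Rmult_comm. apply Rmult_le_compat_l; [apply Rabs_pos|].
    apply Rmin_glb; lra.
Qed.

Lemma Rabs_sin_sub (v : R) : Rabs (sin v - v) <= Rabs v * Rabs v.
Proof.
  destruct (MVT_gen (fun t => sin t - t) 0 v (fun t => cos t - 1)) as [c [Hcv Hc]].
  - intros; auto_derive; auto; ring.
  - intros; apply continuity_pt_minus; [apply continuity_sin|apply continuity_pt_id].
  - rewrite sin_0, !Rminus_0_r in Hc. rewrite Hc, Rabs_mult.
    apply MVT_abs_le in Hcv.
    assert (H := Rabs_cos_sub1 c).
    assert (H2 := Rmin_l 1 (Rabs c)). assert (H3 := Rabs_pos c). assert (H4 := Rabs_pos v).
    apply Rmult_le_compat_r; [exact H4|]. nra.
Qed.

Lemma exp_sub1_bounds (u t : R) :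
  Rabs u <= t -> Rabs (exp u - 1) <= t * exp t /\ Rabs (exp u - 1 - u) <= t * t * exp t.
Proof.
  intros Hu.
  assert (H1 := exp_ineq1_le u). assert (H2 := exp_ineq1_le (- u)).
  assert (H3 : exp u * exp (- u) = 1) by (rewrite <- exp_plus, Rplus_opp_r; apply exp_0).
  assert (Hp := exp_pos u).
  assert (H4 : exp u - 1 <= u * exp u) by nra.
  assert (H5 := exp_ineq1_le t).
  assert (Ht : 0 <= t) by (generalize (Rabs_pos u); lra).
  assert (H6 : exp u <= exp t).
  { destruct (Rle_lt_or_eq_dec u t) as [H| ->]; [split_Rabs; lra| |lra].
    left; apply exp_increasing; auto. }
  destruct (Rle_lt_dec 0 u) as [H0|H0].
  - rewrite Rabs_pos_eq in Hu by auto.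
    split; rewrite Rabs_pos_eq by lra.
    + apply Rle_trans with (u * exp u); [lra|]. apply Rmult_le_compat; lra.
    + apply Rle_trans with (u * (u * exp u)); [nra|].
      rewrite Rmult_assoc. apply Rmult_le_compat; nra.
  - rewrite Rabs_left in Hu by auto.
    assert (exp u - 1 <= 0) by nra.
    split.
    + rewrite Rabs_left1 by lra. nra.
    + rewrite Rabs_pos_eq by lra.
      apply Rle_trans with (u * u); [nra|].
      apply Rle_trans with (t * t); nra.
Qed.

Lemma Cmod_le_components (z : C) : Cmod z <= Rabs (Re z) + Rabs (Im z).
Proof.
  destruct z as [a b]. simpl.
  replace (a, b) with (Cplus (a, 0) (0, b)) by (unfold Cplus; simpl; f_equal; ring).
  eapply Rle_trans; [apply Cmod_triangle|].
  unfold Cmod; simpl.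
  apply Rplus_le_compat; right; rewrite <- sqrt_Rsqr_abs; f_equal; unfold Rsqr; ring.
Qed.

(** Second order is required because the linear parts of 1 + z/(n+2) and of exp(-z (ln(n+2) -
    ln(n+1))) must cancel against each other in Gauss's product. *)
Lemma Cexp_second_order (y : C) :
  Cmod (Cminus (Cminus (Cexp y) (RtoC 1)) y) <= 4 * (Cmod y * Cmod y * exp (Cmod y)).
Proof.
  set (t := Cmod y).
  assert (Hu : Rabs (Re y) <= t) by apply re_le_Cmod.
  assert (Hv : Rabs (Im y) <= t) by apply im_le_Cmod.
  destruct y as [u v]; simpl in Hu, Hv.
  eapply Rle_trans; [apply Cmod_le_components|]. unfold Cexp; simpl.
  destruct (exp_sub1_bounds u t Hu) as [He1 He2].
  assert (Ht : 0 <= t) by (generalize (Rabs_pos u); lra).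
  assert (H5 := exp_ineq1_le t).
  assert (Hc := Rabs_cos_sub1 v). assert (Hs := Rabs_sin_sub v).
  assert (Hs1 := Rabs_sin_le v).
  assert (Hcb : Rabs (cos v) <= 1) by (apply Rabs_le; generalize (COS_bound v); lra).
  assert (Hvv : Rabs v * Rabs v <= t * t) by (apply Rmult_le_compat; auto using Rabs_pos).
  assert (Hc2 : Rabs (cos v - 1) <= t * t).
  { eapply Rle_trans; [exact Hc|]. eapply Rle_trans; [|exact Hvv].
    apply Rmult_le_compat_l; [apply Rabs_pos|apply Rmin_r]. }
  assert (A1 : Rabs (exp u * cos v + - (1) + - u) <= 2 * (t * t * exp t)).
  { replace (exp u * cos v + - (1) + - u)
      with ((exp u - 1 - u) * cos v + (1 + u) * (cos v - 1)) by ring.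
    eapply Rle_trans; [apply Rabs_triang|]. rewrite !Rabs_mult.
    assert (Rabs (exp u - 1 - u) * Rabs (cos v) <= t * t * exp t * 1)
      by (apply Rmult_le_compat; auto using Rabs_pos).
    assert (Rabs (1 + u) * Rabs (cos v - 1) <= exp t * (t * t)).
    { apply Rmult_le_compat; auto using Rabs_pos.
      eapply Rle_trans; [apply Rabs_triang|]. rewrite Rabs_R1. lra. }
    lra. }
  assert (A2 : Rabs (exp u * sin v + - 0 + - v) <= 2 * (t * t * exp t)).
  { replace (exp u * sin v + - 0 + - v)
      with ((exp u - 1) * sin v + (sin v - v)) by ring.
    eapply Rle_trans; [apply Rabs_triang|]. rewrite !Rabs_mult.
    assert (Rabs (exp u - 1) * Rabs (sin v) <= t * exp t * t)
      by (apply Rmult_le_compat; auto using Rabs_pos; lra).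
    assert (0 <= t * t * t) by (repeat apply Rmult_le_pos; lra).
    assert (t * t * (1 + t) <= t * t * exp t) by (apply Rmult_le_compat_l; nra).
    nra. }
  lra.
Qed.

Lemma Cexp_plus (y z : C) : Cexp (Cplus y z) = Cmult (Cexp y) (Cexp z).
Proof.
  destruct y as [a b], z as [c d]. unfold Cexp, Cmult, Cplus; simpl.
  rewrite exp_plus, cos_plus, sin_plus. f_equal; ring.
Qed.

Lemma Cmod_Cexp (z : C) : Cmod (Cexp z) = exp (Re z).
Proof.
  unfold Cmod, Cexp; simpl.
  replace (exp (Re z) * cos (Im z) * (exp (Re z) * cos (Im z) * 1)
           + exp (Re z) * sin (Im z) * (exp (Re z) * sin (Im z) * 1))
    with (exp (Re z) * exp (Re z) * (Rsqr (sin (Im z)) + Rsqr (cos (Im z))))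
    by (unfold Rsqr; ring).
  rewrite sin2_cos2, Rmult_1_r. apply sqrt_square. left; apply exp_pos.
Qed.

Lemma Cexp_neq0 (z : C) : Cexp z <> RtoC 0.
Proof.
  intros H. apply (f_equal Cmod) in H. rewrite Cmod_Cexp, Cmod_0 in H.
  generalize (exp_pos (Re z)). lra.
Qed.

Definition gauss_seq (z : C) (n : nat) : C :=
  Cdiv (poch z (S n)) (Cmult (RtoC (INR (fact n))) (Cexp (Cmult z (RtoC (ln (INR n)))))).

Lemma ln_succ_bounds (n : nat) :
  let d := ln (INR n + 2) - ln (INR n + 1) in
  / (INR n + 2) <= d <= / (INR n + 1).
Proof.
  assert (Hn := pos_INR n). simpl.
  rewrite <- ln_div by lra.
  assert (Hln : forall t, 0 < t -> ln t <= t - 1).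
  { intros t Ht. assert (H := exp_ineq1_le (ln t)). rewrite exp_ln in H; lra. }
  split.
  - assert (H := Hln ((INR n + 1) / (INR n + 2)) ltac:(apply Rdiv_lt_0_compat; lra)).
    rewrite ln_div in H by lra. rewrite ln_div by lra.
    replace ((INR n + 1) / (INR n + 2) - 1) with (- / (INR n + 2)) in H by (field; lra). lra.
  - eapply Rle_trans; [apply Hln; apply Rdiv_lt_0_compat; lra|].
    right; field; lra.
Qed.

Lemma RtoC_INR_neq0 (n : nat) : RtoC (INR (S n)) <> RtoC 0.
Proof. intros H. apply RtoC_inj in H. apply (not_0_INR (S n)); auto. Qed.

Lemma RtoC_fact_neq0 (n : nat) : RtoC (INR (fact n)) <> RtoC 0.
Proof. intros H. apply RtoC_inj in H. exact (INR_fact_neq_0 n H). Qed.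

Lemma Cexp_RtoC (t : R) : Cexp (RtoC t) = RtoC (exp t).
Proof.
  unfold Cexp, RtoC, Re, Im; cbn [fst snd].
  rewrite cos_0, sin_0. f_equal; ring.
Qed.

(** The recursion is taken from index 1 on, since at index 0 the logarithm [ln 0] is only a default
    value. *)
Lemma gauss_seq_succ (z : C) (n : nat) :
  gauss_seq z (S (S n)) =
  Cmult (gauss_seq z (S n))
    (Cmult (Cplus (RtoC 1) (Cmult z (RtoC (/ (INR n + 2)))))
       (Cexp (Cmult (Copp z) (RtoC (ln (INR n + 2) - ln (INR n + 1)))))).
Proof.
  unfold gauss_seq.
  replace (INR (S (S n))) with (INR n + 2) by (rewrite !S_INR; ring).
  replace (INR (S n)) with (INR n + 1) by (rewrite !S_INR; ring).
  change (poch z (S (S (S n)))) with (Cmult (poch z (S (S n))) (Cplus z (RtoC (INR (S (S n)))))).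
  replace (INR (S (S n))) with (INR n + 2) by (rewrite !S_INR; ring).
  set (P := poch z (S (S n))).
  change (fact (S (S n))) with (S (S n) * fact (S n))%nat.
  rewrite mult_INR. replace (INR (S (S n))) with (INR n + 2) by (rewrite !S_INR; ring).
  rewrite RtoC_mult.
  set (A := Cexp (Cmult z (RtoC (ln (INR n + 1))))).
  set (B := Cexp (Cmult z (RtoC (ln (INR n + 2))))).
  set (D := Cexp (Cmult (Copp z) (RtoC (ln (INR n + 2) - ln (INR n + 1))))).
  assert (HA : A = Cmult B D).
  { unfold A, B, D. rewrite <- Cexp_plus. f_equal. rewrite RtoC_minus. ring. }
  assert (HB : B <> RtoC 0) by apply Cexp_neq0.
  assert (HD : D <> RtoC 0) by apply Cexp_neq0.
  assert (HF := RtoC_fact_neq0 (S n)). set (F := RtoC (INR (fact (S n)))) in *.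
  assert (HN : RtoC (INR n + 2) <> RtoC 0)
    by (intros H; apply RtoC_inj in H; generalize (pos_INR n); lra).
  rewrite RtoC_inv by (generalize (pos_INR n); lra).
  rewrite HA. field. repeat split; auto.
Qed.

Lemma ex_Clim_gauss (z : C) : ex_Clim (gauss_seq z).
Proof.
  set (t := Cmod z). assert (Ht : 0 <= t) by apply Cmod_ge_0.
  set (K1 := 4 * (t * t * exp t)).
  assert (HK1 : 0 <= K1) by (unfold K1; generalize (exp_pos t); intros; nra).
  (* The three summands bound the three terms of the decomposition below; the factor 2 pays for g <=
     2 h, that is 1/(n+1) <= 2/(n+2). *)
  set (K := 2 * ((1 + t) * K1 + t + t * t)).
  assert (HC : ex_Clim (fun n => gauss_seq z (S n))).
  { eapply (ex_Clim_product _ _ K); [unfold K; nra|intros n; apply gauss_seq_succ|].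
    intros n. assert (Hn := pos_INR n).
    destruct (ln_succ_bounds n) as [Hd1 Hd2].
    set (d := ln (INR n + 2) - ln (INR n + 1)) in *.
    set (h := / (INR n + 2)) in *. set (g := / (INR n + 1)) in *.
    assert (Hh : 0 < h) by (apply Rinv_0_lt_compat; lra).
    assert (Hg1 : g <= 1).
    { unfold g. rewrite <- Rinv_1. apply Rinv_le_contravar; lra. }
    assert (Hgh : g - h = g * h) by (unfold g, h; field; lra).
    assert (Hg2 : g <= 2 * h).
    { unfold g, h. apply Rmult_le_reg_r with ((INR n + 1) * (INR n + 2)); [nra|].
      field_simplify; lra. }
    set (y := Cmult (Copp z) (RtoC d)).
    assert (Hy : Cmod y = t * d).
    { unfold y. rewrite Cmod_mult, Cmod_opp, Cmod_R, Rabs_pos_eq by lra. reflexivity. }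
    assert (He := Cexp_second_order y). rewrite Hy in He.
    set (e := Cminus (Cminus (Cexp y) (RtoC 1)) y) in *.
    (* With exp y = 1 + y + e and y = -z d, the linear terms combine to z (h - d). As h <= d <= g
       and g - h = g h, all three remaining terms are of order 1/n^2. *)
    replace (Cminus (Cmult (Cplus (RtoC 1) (Cmult z (RtoC h))) (Cexp y)) (RtoC 1))
      with (Cplus (Cplus (Cmult (Cplus (RtoC 1) (Cmult z (RtoC h))) e)
                    (Cmult z (RtoC (h - d))))
              (Copp (Cmult (Cmult z z) (RtoC (h * d)))))
      by (unfold e, y; rewrite RtoC_minus, RtoC_mult; ring).
    assert (He' : Cmod e <= K1 * (g * g)).
    { eapply Rle_trans; [exact He|]. unfold K1.
      assert (exp (t * d) <= exp t).
      { destruct (Rle_lt_or_eq_dec (t * d) t) as [H|H]; [nra| |rewrite H; lra].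
        left; apply exp_increasing; auto. }
      assert (t * d * (t * d) <= t * t * (g * g)).
      { replace (t * d * (t * d)) with (t * t * (d * d)) by ring.
        apply Rmult_le_compat_l; nra. }
      replace (4 * (t * t * exp t) * (g * g)) with (4 * (t * t * (g * g) * exp t)) by ring.
      apply Rmult_le_compat_l; [lra|].
      apply Rmult_le_compat; auto; [nra|left; apply exp_pos]. }
    assert (H1 : Cmod (Cmult (Cplus (RtoC 1) (Cmult z (RtoC h))) e) <= (1 + t) * (K1 * (g * g))).
    { rewrite Cmod_mult. apply Rmult_le_compat; auto using Cmod_ge_0.
      eapply Rle_trans; [apply Cmod_triangle|]. rewrite Cmod_1, Cmod_mult, Cmod_R, Rabs_pos_eq by lra.
      fold t. assert (h <= 1) by lra. nra. }
    assert (H2 : Cmod (Cmult z (RtoC (h - d))) <= t * (g * h)).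
    { rewrite Cmod_mult, Cmod_R. apply Rmult_le_compat_l; auto.
      rewrite Rabs_left1 by lra. lra. }
    assert (H3 : Cmod (Copp (Cmult (Cmult z z) (RtoC (h * d)))) <= t * t * (g * h)).
    { rewrite Cmod_opp, !Cmod_mult, Cmod_R. fold t. apply Rmult_le_compat_l; [nra|].
      rewrite Rabs_pos_eq; nra. }
    eapply Rle_trans; [apply Cmod_triangle|].
    eapply Rle_trans; [apply Rplus_le_compat; [apply Cmod_triangle|apply H3]|].
    eapply Rle_trans; [apply Rplus_le_compat; [apply Rplus_le_compat; [apply H1|apply H2]|apply Rle_refl]|].
    rewrite Hgh. unfold K.
    assert (g * g <= 2 * (g * h)) by nra.
    assert (0 <= g * h) by nra.
    assert ((1 + t) * (K1 * (g * g)) <= (1 + t) * K1 * (2 * (g * h))).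
    { rewrite <- Rmult_assoc. apply Rmult_le_compat_l; [nra|auto]. }
    nra. }
  destruct HC as [[l1 H1] [l2 H2]].
  split; [exists l1|exists l2]; apply is_lim_seq_incr_1; assumption.
Qed.

Lemma is_lim_seq_Lim_real (u : nat -> R) :
  ex_finite_lim_seq u -> is_lim_seq u (real (Lim_seq u)).
Proof. intros [l Hl]. rewrite (is_lim_seq_unique _ _ Hl). exact Hl. Qed.

Lemma poch_shift (z : C) (n : nat) :
  poch z (S n) = Cmult z (poch (Cplus z (RtoC 1)) n).
Proof.
  induction n as [|n IH].
  - simpl. ring.
  - change (poch z (S (S n))) with (Cmult (poch z (S n)) (Cplus z (RtoC (INR (S n))))).
    rewrite IH. simpl poch. rewrite S_INR, RtoC_plus. ring.
Qed.


Lemma gauss_seq_shift (z : C) (n : nat) :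
  Cmult (gauss_seq z (S n))
    (Cplus (RtoC 1) (Cmult (Cplus z (RtoC 1)) (RtoC (/ (INR n + 1))))) =
  Cmult z (gauss_seq (Cplus z (RtoC 1)) (S n)).
Proof.
  unfold gauss_seq.
  assert (Hp : Cmult (poch z (S (S n))) (Cplus z (RtoC (INR n + 2)))
               = Cmult z (poch (Cplus z (RtoC 1)) (S (S n)))).
  { rewrite <- poch_shift.
    change (poch z (S (S (S n)))) with (Cmult (poch z (S (S n))) (Cplus z (RtoC (INR (S (S n)))))).
    rewrite !S_INR. do 3 f_equal. ring. }
  assert (HN : 0 < INR (S n)) by (apply lt_0_INR; lia).
  replace (INR n + 1) with (INR (S n)) by (rewrite S_INR; ring).
  replace (INR n + 2) with (INR (S n) + 1) in Hp by (rewrite S_INR; ring).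
  rewrite RtoC_plus in Hp.
  assert (He : Cexp (Cmult (Cplus z (RtoC 1)) (RtoC (ln (INR (S n)))))
               = Cmult (Cexp (Cmult z (RtoC (ln (INR (S n)))))) (RtoC (INR (S n)))).
  { replace (Cmult (Cplus z (RtoC 1)) (RtoC (ln (INR (S n)))))
      with (Cplus (Cmult z (RtoC (ln (INR (S n))))) (RtoC (ln (INR (S n))))) by ring.
    rewrite Cexp_plus, Cexp_RtoC, exp_ln by auto. reflexivity. }
  rewrite He, RtoC_inv by lra.
  assert (H1 := Cexp_neq0 (Cmult z (RtoC (ln (INR (S n)))))).
  set (E := Cexp (Cmult z (RtoC (ln (INR (S n)))))) in *.
  assert (H2 := RtoC_fact_neq0 (S n)). assert (H3 := RtoC_INR_neq0 n).
  set (F := RtoC (INR (fact (S n)))) in *. set (M := RtoC (INR (S n))) in *.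
  set (P := poch z (S (S n))) in *. set (Q := poch (Cplus z (RtoC 1)) (S (S n))) in *.
  transitivity (Cdiv (Cmult P (Cplus z (Cplus M (RtoC 1)))) (Cmult F (Cmult E M))).
  - field. repeat split; auto.
  - rewrite Hp. field. repeat split; auto.
Qed.

Lemma is_lim_seq_inv_succ : is_lim_seq (fun n => / (INR n + 1)) 0.
Proof.
  apply (is_lim_seq_inv _ p_infty); [|discriminate].
  apply (is_lim_seq_plus _ _ p_infty 1); [apply is_lim_seq_INR|apply is_lim_seq_const|reflexivity].
Qed.

(** Limit of [gauss_seq_shift], whose correction factor 1 + (z+1)/(n+1) tends to 1. Because [Clim]
    is componentwise, the limit is taken separately in real and imaginary parts. *)
Lemma rGamma_rec (z : C) : rGamma z = Cmult z (rGamma (Cplus z (RtoC 1))).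
Proof.
  destruct (ex_Clim_gauss z) as [Hr Hi].
  destruct (ex_Clim_gauss (Cplus z (RtoC 1))) as [Hr1 Hi1].
  apply is_lim_seq_Lim_real in Hr, Hi, Hr1, Hi1.
  change (rGamma z) with (real (Lim_seq (fun n => Re (gauss_seq z n))),
                          real (Lim_seq (fun n => Im (gauss_seq z n)))).
  change (rGamma (Cplus z (RtoC 1)))
    with (real (Lim_seq (fun n => Re (gauss_seq (Cplus z (RtoC 1)) n))),
          real (Lim_seq (fun n => Im (gauss_seq (Cplus z (RtoC 1)) n)))).
  set (A := real (Lim_seq (fun n => Re (gauss_seq z n)))) in *.
  set (B := real (Lim_seq (fun n => Im (gauss_seq z n)))) in *.
  set (A1 := real (Lim_seq (fun n => Re (gauss_seq (Cplus z (RtoC 1)) n)))) in *.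
  set (B1 := real (Lim_seq (fun n => Im (gauss_seq (Cplus z (RtoC 1)) n)))) in *.
  apply is_lim_seq_incr_1 in Hr, Hi, Hr1, Hi1.
  set (e1 := fun n : nat => 1 + (Re z + 1) * / (INR n + 1)).
  set (e2 := fun n : nat => Im z * / (INR n + 1)).
  assert (He1 : is_lim_seq e1 1).
  { replace (Finite 1) with (Finite (1 + (Re z + 1) * 0)) by (f_equal; ring).
    apply is_lim_seq_plus'; [apply is_lim_seq_const|].
    apply is_lim_seq_mult'; [apply is_lim_seq_const|apply is_lim_seq_inv_succ]. }
  assert (He2 : is_lim_seq e2 0).
  { replace (Finite 0) with (Finite (Im z * 0)) by (f_equal; ring).
    apply is_lim_seq_mult'; [apply is_lim_seq_const|apply is_lim_seq_inv_succ]. }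
  assert (Hs := gauss_seq_shift z).
  assert (HR : forall n, Re (gauss_seq z (S n)) * e1 n - Im (gauss_seq z (S n)) * e2 n
     = Re z * Re (gauss_seq (Cplus z (RtoC 1)) (S n)) - Im z * Im (gauss_seq (Cplus z (RtoC 1)) (S n))).
  { intros n. generalize (f_equal Re (Hs n)). unfold e1, e2.
    destruct (gauss_seq z (S n)), (gauss_seq (Cplus z (RtoC 1)) (S n)), z. unfold Re, Im; cbn -[Rinv]. intros E; lra. }
  assert (HI : forall n, Re (gauss_seq z (S n)) * e2 n + Im (gauss_seq z (S n)) * e1 n
     = Re z * Im (gauss_seq (Cplus z (RtoC 1)) (S n)) + Im z * Re (gauss_seq (Cplus z (RtoC 1)) (S n))).
  { intros n. generalize (f_equal Im (Hs n)). unfold e1, e2.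
    destruct (gauss_seq z (S n)), (gauss_seq (Cplus z (RtoC 1)) (S n)), z. unfold Re, Im; cbn -[Rinv]. intros E; lra. }
  assert (L1 := is_lim_seq_minus' _ _ _ _ (is_lim_seq_mult' _ _ _ _ Hr He1) (is_lim_seq_mult' _ _ _ _ Hi He2)).
  assert (L2 := is_lim_seq_plus' _ _ _ _ (is_lim_seq_mult' _ _ _ _ Hr He2) (is_lim_seq_mult' _ _ _ _ Hi He1)).
  assert (L3 := is_lim_seq_minus' _ _ _ _
     (is_lim_seq_mult' _ _ _ _ (is_lim_seq_const (Re z)) Hr1) (is_lim_seq_mult' _ _ _ _ (is_lim_seq_const (Im z)) Hi1)).
  assert (L4 := is_lim_seq_plus' _ _ _ _
     (is_lim_seq_mult' _ _ _ _ (is_lim_seq_const (Re z)) Hi1) (is_lim_seq_mult' _ _ _ _ (is_lim_seq_const (Im z)) Hr1)).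
  apply (is_lim_seq_ext _ _ _ HR) in L1. apply (is_lim_seq_ext _ _ _ HI) in L2.
  apply is_lim_seq_unique in L1, L2, L3, L4. rewrite L1 in L3. rewrite L2 in L4.
  injection L3. injection L4. intros E4 E3.
  unfold Cmult; simpl. unfold Re, Im in E3, E4. f_equal; lra.
Qed.

Lemma Gamma_rec (z : C) : z <> RtoC 0 -> Gamma (Cplus z (RtoC 1)) = Cmult z (Gamma z).
Proof.
  intros Hz. unfold Gamma. rewrite (rGamma_rec z).
  set (g := rGamma (Cplus z (RtoC 1))).
  (* Where the reciprocal gamma function vanishes, both sides are 0 by the convention for [Cinv] at
     0, so the equation persists. *)
  destruct (Ceq_dec g (RtoC 0)) as [->|Hg].
  - replace (Cmult z (RtoC 0)) with (RtoC 0) by ring.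
    replace (Cinv (RtoC 0)) with (RtoC 0); [ring|].
    unfold Cinv, RtoC, Rdiv; simpl fst; simpl snd.
    rewrite Ropp_0, !Rmult_0_l. reflexivity.
  - field. auto.
Qed.

(** * The hypergeometric series on the real axis *)

Definition absprod (l : list C) (w : R) : R :=
  fold_right Rmult 1 (map (fun u => Cmod (Cplus (RtoC w) u)) l).

Definition gamma_regular (us : list C) (w : R) : Prop :=
  List.Forall (fun u => ~ nonpos_int (Cplus (RtoC w) u)) us.

Lemma Cprod_Gamma_rec (us : list C) (w : R) :
  gamma_regular us w ->
  Cprod (map (fun u => Gamma (Cplus (RtoC (w + 1)) u)) us) =
  Cmult (Cprod (map (fun u => Cplus (RtoC w) u) us))
        (Cprod (map (fun u => Gamma (Cplus (RtoC w) u)) us)).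
Proof.
  unfold Cprod. induction us as [|u us IH]; intros H; simpl.
  - ring.
  - inversion H as [|? ? H1 H2]; subst. rewrite IH by exact H2.
    replace (Cplus (RtoC (w + 1)) u) with (Cplus (Cplus (RtoC w) u) (RtoC 1))
      by (rewrite RtoC_plus; ring).
    rewrite Gamma_rec; [ring|].
    intros E. apply H1. exists O. rewrite E. simpl. now rewrite Ropp_0.
Qed.

Lemma Cprod_rGamma_rec (vs : list C) (w : R) :
  Cprod (map (fun v => rGamma (Cplus (RtoC w) v)) vs) =
  Cmult (Cprod (map (fun v => Cplus (RtoC w) v) vs))
        (Cprod (map (fun v => rGamma (Cplus (RtoC (w + 1)) v)) vs)).
Proof.
  unfold Cprod. induction vs as [|v vs IH]; simpl.
  - ring.
  - rewrite IH, (rGamma_rec (Cplus (RtoC w) v)).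
    replace (Cplus (Cplus (RtoC w) v) (RtoC 1)) with (Cplus (RtoC (w + 1)) v)
      by (rewrite RtoC_plus; ring).
    ring.
Qed.

Lemma Cmod_Cprod_shift (l : list C) (w : R) :
  Cmod (Cprod (map (fun u => Cplus (RtoC w) u) l)) = absprod l w.
Proof.
  unfold Cprod, absprod. induction l as [|u l IH]; simpl.
  - apply Cmod_1.
  - now rewrite Cmod_mult, IH.
Qed.

Fixpoint rpoch (y : R) (n : nat) : R :=
  match n with
  | O => 1
  | S k => rpoch y k * (y + INR k)
  end.

(* [D = 1] gives the terms of Gauss' series; other values of [D] arise for its tails. *)
Definition hterm (A B C D x : R) (n : nat) : R :=
  rpoch A n * rpoch B n / (rpoch C n * rpoch D n) * x ^ n.

Definition hseries (A B C D x : R) : R := Series (hterm A B C D x).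

Lemma rpoch_1 (n : nat) : rpoch 1 n = INR (fact n).
Proof.
  induction n as [|n IH]; [reflexivity|].
  change (fact (S n)) with (S n * fact n)%nat.
  rewrite mult_INR, <- IH, S_INR. simpl. ring.
Qed.

Lemma poch_RtoC (y : R) (n : nat) : poch (RtoC y) n = RtoC (rpoch y n).
Proof.
  induction n as [|n IH]; simpl; [reflexivity|].
  now rewrite IH, RtoC_mult, RtoC_plus.
Qed.

Lemma rpoch_neq0 (y : R) (n : nat) :
  (forall j, (j < n)%nat -> y + INR j <> 0) -> rpoch y n <> 0.
Proof.
  induction n as [|n IH]; intros H; simpl; [lra|].
  apply Rmult_integral_contrapositive_currified; [apply IH; intros; apply H; lia|apply H; lia].
Qed.

Lemma rpoch_add (y : R) (m n : nat) :
  rpoch y (m + n) = rpoch y m * rpoch (y + INR m) n.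
Proof.
  induction n as [|n IH].
  - rewrite Nat.add_0_r. simpl. ring.
  - rewrite Nat.add_succ_r. simpl. rewrite IH, plus_INR. ring.
Qed.

Lemma rpoch_pos (y : R) (n : nat) : 0 < y -> 0 < rpoch y n.
Proof.
  intros Hy. induction n as [|n IH]; simpl; [lra|].
  apply Rmult_lt_0_compat; [exact IH|]. generalize (pos_INR n); lra.
Qed.

Lemma Rabs_rpoch_le (y Y : R) (n : nat) : Rabs y <= Y -> Rabs (rpoch y n) <= rpoch Y n.
Proof.
  intros Hy. induction n as [|n IH]; simpl; [rewrite Rabs_R1; lra|].
  rewrite Rabs_mult. apply Rmult_le_compat; auto using Rabs_pos.
  eapply Rle_trans; [apply Rabs_triang|]. rewrite (Rabs_pos_eq (INR n)) by apply pos_INR. lra.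
Qed.

Lemma rpoch_le (y Y : R) (n : nat) : 0 <= y <= Y -> rpoch y n <= rpoch Y n.
Proof.
  intros Hy. eapply Rle_trans; [apply Rle_abs|]. apply Rabs_rpoch_le.
  rewrite Rabs_pos_eq; lra.
Qed.

(** Since division by zero yields zero, [Rinv_mult] is unconditional and the identity survives where
    a Pochhammer symbol in the denominator vanishes. *)
Lemma hterm_shift (A B C D x : R) (N m : nat) :
  hterm A B C D x (N + m) =
  hterm A B C D x N * hterm (A + INR N) (B + INR N) (C + INR N) (D + INR N) x m.
Proof.
  unfold hterm. rewrite !rpoch_add, pow_add. unfold Rdiv. rewrite !Rinv_mult. ring.
Qed.

Lemma hterm_pos (A B C D x : R) (n : nat) :
  0 < A -> 0 < B -> 0 < C -> 0 < D -> 0 < x -> 0 < hterm A B C D x n.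
Proof.
  intros. unfold hterm. apply Rmult_lt_0_compat; [|apply pow_lt; auto].
  apply Rdiv_lt_0_compat; apply Rmult_lt_0_compat; apply rpoch_pos; auto.
Qed.

Lemma is_lim_seq_affine_ratio (a b : R) : 0 < b ->
  is_lim_seq (fun n => (a + INR n) / (b + INR n)) 1.
Proof.
  intros Hb.
  apply (is_lim_seq_ext (fun n => 1 + (a - b) * / (b + INR n))).
  - intros n. generalize (pos_INR n). intros. field. lra.
  - replace (Finite 1) with (Finite (1 + (a - b) * 0)) by (f_equal; ring).
    apply is_lim_seq_plus'; [apply is_lim_seq_const|].
    apply is_lim_seq_mult'; [apply is_lim_seq_const|].
    apply (is_lim_seq_inv _ p_infty); [|discriminate].
    apply (is_lim_seq_plus _ _ b p_infty); [apply is_lim_seq_const|apply is_lim_seq_INR|reflexivity].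
Qed.

Lemma ex_series_hterm_pos (A B C D x : R) :
  0 < A -> 0 < B -> 0 < C -> 0 < D -> 0 < x < 1 -> ex_series (hterm A B C D x).
Proof.
  intros HA HB HC HD [Hx0 Hx1].
  apply (ex_series_ext (fun n => Rabs (hterm A B C D x n))).
  { intros n. apply Rabs_pos_eq. left. now apply hterm_pos. }
  apply (ex_series_DAlembert _ x Hx1).
  { intros n. apply Rgt_not_eq, hterm_pos; auto. }
  apply (is_lim_seq_ext (fun n => (A + INR n) / (C + INR n) * ((B + INR n) / (D + INR n)) * x)).
  - intros n. rewrite Rabs_pos_eq.
    2:{ left. apply Rdiv_lt_0_compat; apply hterm_pos; auto. }
    generalize (hterm_pos A B C D x n HA HB HC HD Hx0).
    replace (S n) with (n + 1)%nat by lia. rewrite hterm_shift.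
    intros Hn. unfold hterm at 2; simpl. generalize (pos_INR n); intros.
    field. repeat split; lra.
  - replace (Finite x) with (Finite (1 * 1 * x)) by (f_equal; ring).
    apply is_lim_seq_mult'; [|apply is_lim_seq_const].
    apply is_lim_seq_mult'; now apply is_lim_seq_affine_ratio.
Qed.

Lemma Rabs_hterm_le (A A1 B C c D x : R) (n : nat) :
  Rabs A <= A1 -> 0 < B -> 0 < c <= C -> 0 < D -> 0 < x ->
  Rabs (hterm A B C D x n) <= hterm A1 B c D x n.
Proof.
  intros HA HB Hc HD Hx. unfold hterm, Rdiv.
  assert (HpB := rpoch_pos B n HB). assert (HpD := rpoch_pos D n HD).
  assert (Hpc := rpoch_pos c n (proj1 Hc)).
  assert (HpC : 0 < rpoch C n) by (apply rpoch_pos; lra).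
  assert (HcC : rpoch c n <= rpoch C n) by (apply rpoch_le; lra).
  rewrite !Rabs_mult, (Rabs_pos_eq (rpoch B n)) by lra.
  rewrite (Rabs_pos_eq (x ^ n)) by (left; apply pow_lt; auto).
  rewrite (Rabs_pos_eq (/ _)) by (left; apply Rinv_0_lt_compat, Rmult_lt_0_compat; lra).
  apply Rmult_le_compat_r; [left; apply pow_lt; auto|].
  apply Rmult_le_compat.
  - apply Rmult_le_pos; [apply Rabs_pos|lra].
  - left; apply Rinv_0_lt_compat, Rmult_lt_0_compat; lra.
  - apply Rmult_le_compat_r; [lra|]. now apply Rabs_rpoch_le.
  - apply Rinv_le_contravar; [apply Rmult_lt_0_compat; lra|].
    apply Rmult_le_compat_r; lra.
Qed.

(** After finitely many terms the third parameter is positive, and the rest is dominated by a series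
    with positive parameters, to which the ratio test applies. *)
Lemma ex_series_hterm (A B C D x : R) :
  0 < B -> 0 < D -> 0 < x < 1 -> ex_series (hterm A B C D x).
Proof.
  intros HB HD Hx.
  destruct (INR_unbounded (- C)) as [N HN].
  apply (ex_series_incr_n _ N).
  apply (ex_series_ext (fun m => scal (hterm A B C D x N)
     (hterm (A + INR N) (B + INR N) (C + INR N) (D + INR N) x m))).
  { intros m. now rewrite hterm_shift. }
  apply (ex_series_scal (V := R_NormedModule)).
  assert (HNp := pos_INR N). assert (HaN := Rabs_pos (A + INR N)).
  apply (ex_series_le (V := R_CompleteNormedModule) _ (hterm (Rabs (A + INR N) + 1) (B + INR N) (C + INR N) (D + INR N) x)).
  - intros n. change norm with Rabs. apply Rabs_hterm_le; lra.
  - apply ex_series_hterm_pos; lra.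
Qed.

(** For large N the series on the right has a positive third parameter and depends continuously on
    its parameters; all singular behaviour in C is confined to finitely many explicit factors.
    Continuity and residues of f are both read off from this form. *)
Lemma hseries_split (A B C D x : R) (N : nat) :
  0 < B -> 0 < D -> 0 < x < 1 ->
  hseries A B C D x =
  sum_f_R0 (hterm A B C D x) N +
  hterm A B C D x (S N) *
  hseries (A + INR (S N)) (B + INR (S N)) (C + INR (S N)) (D + INR (S N)) x.
Proof.
  intros HB HD Hx. unfold hseries.
  rewrite (Series_incr_n _ (S N)) by (lia || now apply ex_series_hterm).
  simpl Nat.pred. f_equal.
  rewrite <- Series_scal_l. apply Series_ext. intros m. apply hterm_shift.
Qed.

Lemma fold_right_Cplus_RtoC (f : nat -> R) (N : nat) :
  fold_right Cplus (RtoC 0) (map (fun n => RtoC (f n)) (seq 0 (S N))) = RtoC (sum_f_R0 f N).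
Proof.
  assert (H : forall l c, fold_right Cplus (RtoC c) (map (fun n => RtoC (f n)) l)
               = Cplus (fold_right Cplus (RtoC 0) (map (fun n => RtoC (f n)) l)) (RtoC c)).
  { induction l as [|i l IH]; intros c; simpl; [ring|]. rewrite IH. ring. }
  induction N as [|N IH].
  - simpl. ring.
  - rewrite seq_S, map_app, fold_right_app. simpl fold_right at 2.
    replace (Cplus (RtoC (f (S N))) (RtoC 0)) with (RtoC (f (S N))) by ring.
    rewrite H, IH. simpl. now rewrite RtoC_plus.
Qed.

Definition freal (p r a x w : R) : R := hseries (p * w + a) (1 / 2) (r * w) 1 x.

Lemma fhyp_RtoC (p r a x w : R) :
  fdom r (RtoC w) -> fhyp p 0 r a (1 / 2) x (RtoC w) = RtoC (freal p r a x w).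
Proof.
  intros Hd. unfold fhyp, hyp2F1, CSeries.
  assert (Hn : forall n, rpoch (r * w) n <> 0).
  { intros n. apply rpoch_neq0. intros j _ E. apply Hd. exists j.
    rewrite <- RtoC_mult. f_equal. lra. }
  assert (E : forall N,
    fold_right Cplus (RtoC 0) (map (fun n =>
      Cmult (Cdiv (Cmult (poch (Cplus (Cmult (RtoC p) (RtoC w)) (RtoC a)) n)
                         (poch (Cplus (Cmult (RtoC 0) (RtoC w)) (RtoC (1 / 2))) n))
                  (Cmult (poch (Cmult (RtoC r) (RtoC w)) n) (RtoC (INR (fact n)))))
            (RtoC (x ^ n))) (seq 0 (S N)))
    = RtoC (sum_n (hterm (p * w + a) (1 / 2) (r * w) 1 x) N)).
  { intros N. rewrite sum_n_Reals, <- fold_right_Cplus_RtoC. f_equal. apply map_ext.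
    intros n. rewrite <- !RtoC_mult, <- !RtoC_plus, !poch_RtoC.
    rewrite Rmult_0_l, Rplus_0_l. unfold hterm. rewrite rpoch_1.
    rewrite <- !RtoC_mult, <- RtoC_div, <- RtoC_mult; [reflexivity|].
    apply Rmult_integral_contrapositive_currified; [apply Hn|apply INR_fact_neq_0]. }
  unfold Clim, freal, hseries, Series, RtoC.
  f_equal.
  - f_equal. apply Lim_seq_ext. intros N. rewrite E. reflexivity.
  - rewrite (Lim_seq_ext _ (fun _ => 0)); [now rewrite Lim_seq_const|].
    intros N. rewrite E. reflexivity.
Qed.

Lemma solution_recurrence (p r a x : R) :
  problemI_solution p 0 r a (1 / 2) x ->
  exists (lam : R) (us vs : list C), 0 < lam /\
    forall w : R,
      fdom r (RtoC w) -> fdom r (RtoC (w + 1)) ->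
      gamma_regular us w -> gamma_regular us (w + 1) ->
      absprod vs w * Rabs (freal p r a x (w + 1)) =
      lam * absprod us w * Rabs (freal p r a x w).
Proof.
  intros (C0 & L & us & vs & HC0 & Hf).
  exists (Cmod (Cexp L)), us, vs. split.
  { rewrite Cmod_Cexp. apply exp_pos. }
  intros w Hd Hd1 Hg Hg1.
  assert (E := Hf (RtoC w) Hd Hg). assert (E1 := Hf (RtoC (w + 1)) Hd1 Hg1).
  rewrite fhyp_RtoC in E, E1 by assumption.
  rewrite Cprod_Gamma_rec in E1 by exact Hg. rewrite Cprod_rGamma_rec in E.
  replace (Cmult L (RtoC (w + 1))) with (Cplus (Cmult L (RtoC w)) L) in E1
    by (rewrite RtoC_plus; ring).
  rewrite Cexp_plus in E1.
  rewrite <- !Cmod_R, <- !Cmod_Cprod_shift, <- !Cmod_mult. f_equal.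
  rewrite E, E1. ring.
Qed.

(** * Residues *)

Lemma Rabs_Series_tail (u M : nat -> R) (N : nat) :
  (forall n, Rabs (u n) <= M n) -> ex_series M ->
  Rabs (Series u - sum_f_R0 u N) <= Series M - sum_f_R0 M N.
Proof.
  intros HuM HM.
  assert (Hu : ex_series u) by (apply (ex_series_le (V := R_CompleteNormedModule) u M); auto).
  rewrite (Series_incr_n u (S N)), (Series_incr_n M (S N)) by (lia || auto).
  simpl Nat.pred.
  replace (sum_f_R0 u N + Series (fun k => u (S N + k)%nat) - sum_f_R0 u N)
    with (Series (fun k => u (S N + k)%nat)) by ring.
  replace (sum_f_R0 M N + Series (fun k => M (S N + k)%nat) - sum_f_R0 M N)
    with (Series (fun k => M (S N + k)%nat)) by ring.
  assert (HMt : ex_series (fun k => M (S N + k)%nat)) by now apply (ex_series_incr_n M).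
  assert (Hut : ex_series (fun k => Rabs (u (S N + k)%nat))).
  { apply (ex_series_le (V := R_CompleteNormedModule) _ (fun k => M (S N + k)%nat)); auto.
    intros n. change norm with Rabs. rewrite Rabs_Rabsolu. apply HuM. }
  eapply Rle_trans; [apply Series_Rabs; exact Hut|].
  apply Series_le; auto. intros n. split; [apply Rabs_pos|apply HuM].
Qed.

Lemma filterlim_sum_f_R0 {T} (F : (T -> Prop) -> Prop) {FF : Filter F}
    (u : nat -> T -> R) (l : nat -> R) (N : nat) :
  (forall n, (n <= N)%nat -> filterlim (u n) F (locally (l n))) ->
  filterlim (fun w => sum_f_R0 (fun n => u n w) N) F (locally (sum_f_R0 l N)).
Proof.
  induction N as [|N IH]; intros H; simpl.
  - apply H; lia.
  - eapply filterlim_comp_2; [apply IH; intros; apply H; lia|apply H; lia|].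
    apply (filterlim_plus (V := R_NormedModule)).
Qed.

(** Tannery's theorem (dominated convergence for series) along an arbitrary filter: the tails are
    uniformly small and the partial sums converge termwise. *)
Lemma filterlim_Series_dominated {T} (F : (T -> Prop) -> Prop) {FF : Filter F}
    (u : nat -> T -> R) (l M : nat -> R) :
  F (fun w => forall n, Rabs (u n w) <= M n) ->
  (forall n, Rabs (l n) <= M n) ->
  (forall n, filterlim (u n) F (locally (l n))) ->
  ex_series M ->
  filterlim (fun w => Series (fun n => u n w)) F (locally (Series l)).
Proof.
  intros HuM HlM Hul HM.
  apply filterlim_locally. intros eps.
  assert (Hc : is_lim_seq (sum_n M) (Series M)) by (apply Series_correct, HM).
  apply is_lim_seq_spec in Hc.
  assert (He : 0 < eps / 3) by (generalize (cond_pos eps); lra).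
  destruct (Hc (mkposreal _ He)) as [N HN]. specialize (HN N (Nat.le_refl _)).
  simpl in HN. rewrite sum_n_Reals in HN.
  assert (Hs := filterlim_sum_f_R0 F u l N (fun n _ => Hul n)).
  apply filterlim_locally with (eps := mkposreal _ He) in Hs.
  eapply filter_imp; [|apply (filter_and _ _ HuM Hs)].
  intros w [Hw1 Hw2].
  change (Rabs (sum_f_R0 (fun n => u n w) N - sum_f_R0 l N) < eps / 3) in Hw2.
  change (Rabs (Series (fun n => u n w) - Series l) < eps).
  assert (H1 := Rabs_Series_tail (fun n => u n w) M N Hw1 HM).
  assert (H2 := Rabs_Series_tail l M N HlM HM).
  assert (H3 : Series M - sum_f_R0 M N < eps / 3).
  { generalize (Rle_abs (- (sum_f_R0 M N - Series M))). rewrite Rabs_Ropp. lra. }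
  split_Rabs; lra.
Qed.

Lemma continuity_pt_rpoch (f : R -> R) (w : R) (n : nat) :
  continuity_pt f w -> continuity_pt (fun t => rpoch (f t) n) w.
Proof.
  intros Hf. induction n as [|n IH]; simpl.
  - apply continuity_pt_const. intros ? ?; reflexivity.
  - apply (continuity_pt_mult _ (fun t => f t + INR n)); [exact IH|].
    apply (continuity_pt_plus f (fun _ => INR n)); [exact Hf|].
    apply continuity_pt_const. intros ? ?; reflexivity.
Qed.

Lemma continuity_pt_affine (p a w : R) : continuity_pt (fun t => p * t + a) w.
Proof.
  apply derivable_continuous_pt. exists p.
  apply is_derive_Reals. auto_derive; auto; ring.
Qed.

Lemma continuity_pt_cst (c w : R) : continuity_pt (fun _ => c) w.
Proof. apply continuity_pt_const. intros ? ?; reflexivity. Qed.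

Lemma continuity_pt_hterm (f g : R -> R) (B D x w : R) (n : nat) :
  continuity_pt f w -> continuity_pt g w ->
  rpoch (g w) n <> 0 -> 0 < D ->
  continuity_pt (fun t => hterm (f t) B (g t) D x n) w.
Proof.
  intros Hf Hg Hn HD. unfold hterm.
  apply (continuity_pt_mult (fun t => rpoch (f t) n * rpoch B n / (rpoch (g t) n * rpoch D n))
           (fun _ => x ^ n)); [|apply continuity_pt_cst].
  apply (continuity_pt_div (fun t => rpoch (f t) n * rpoch B n)
           (fun t => rpoch (g t) n * rpoch D n)).
  - apply (continuity_pt_mult (fun t => rpoch (f t) n) (fun _ => rpoch B n));
      [now apply continuity_pt_rpoch|apply continuity_pt_cst].
  - apply (continuity_pt_mult (fun t => rpoch (g t) n) (fun _ => rpoch D n));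
      [now apply continuity_pt_rpoch|apply continuity_pt_cst].
  - apply Rmult_integral_contrapositive_currified; [exact Hn|].
    generalize (rpoch_pos D n HD); lra.
Qed.

Lemma continuity_pt_hseries (f g : R -> R) (B D x w : R) :
  continuity_pt f w -> continuity_pt g w ->
  0 < B -> 0 < g w -> 0 < D -> 0 < x < 1 ->
  continuity_pt (fun t => hseries (f t) B (g t) D x) w.
Proof.
  intros Hf Hg HB HC HD Hx.
  apply continuity_pt_filterlim. unfold hseries.
  (* Near w the numerator parameter stays below [A1] in absolute value and the denominator parameter
     above [c], which yields one summable majorant. *)
  set (A1 := Rabs (f w) + 1). set (c := g w / 2).
  apply (filterlim_Series_dominated (locally w)
           (fun n t => hterm (f t) B (g t) D x n) (hterm (f w) B (g w) D x) (hterm A1 B c D x)).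
  - apply continuity_pt_filterlim in Hf, Hg.
    assert (Hc : 0 < c) by (unfold c; lra).
    apply filterlim_locally with (eps := mkposreal 1 Rlt_0_1) in Hf.
    apply filterlim_locally with (eps := mkposreal c Hc) in Hg.
    eapply filter_imp; [|apply (filter_and _ _ Hf Hg)].
    intros t [H1 H2] n.
    change (Rabs (f t - f w) < 1) in H1. change (Rabs (g t - g w) < c) in H2.
    apply Rabs_hterm_le; try lra.
    + unfold A1. split_Rabs; lra.
    + unfold c in *. split_Rabs; lra.
  - intros n. apply Rabs_hterm_le; unfold A1, c; try lra.
  - intros n. apply (continuity_pt_filterlim (fun t => hterm (f t) B (g t) D x n)).
    apply continuity_pt_hterm; auto. generalize (rpoch_pos (g w) n HC); lra.
  - apply ex_series_hterm_pos; unfold A1, c; try lra. generalize (Rabs_pos (f w)); lra.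
Qed.

Lemma continuity_pt_sum_f_R0 (u : nat -> R -> R) (w : R) (N : nat) :
  (forall n, (n <= N)%nat -> continuity_pt (u n) w) ->
  continuity_pt (fun t => sum_f_R0 (fun n => u n t) N) w.
Proof.
  induction N as [|N IH]; intros H; simpl.
  - apply H; lia.
  - apply (continuity_pt_plus (fun t => sum_f_R0 (fun n => u n t) N) (u (S N)));
      [apply IH; intros|]; apply H; lia.
Qed.

Lemma continuity_pt_linear (r w : R) : continuity_pt (fun t => r * t) w.
Proof.
  apply (continuity_pt_ext (fun t => r * t + 0)); [intros; ring|apply continuity_pt_affine].
Qed.

Lemma continuity_pt_freal (p r a x w : R) :
  0 < x < 1 -> (forall j : nat, r * w + INR j <> 0) ->
  continuity_pt (freal p r a x) w.
Proof.
  intros Hx Hj.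
  destruct (INR_unbounded (- (r * w))) as [N HN].
  apply (continuity_pt_ext (fun t =>
     sum_f_R0 (fun n => hterm (p * t + a) (1 / 2) (r * t) 1 x n) N +
     hterm (p * t + a) (1 / 2) (r * t) 1 x (S N) *
     hseries (p * t + a + INR (S N)) (1 / 2 + INR (S N)) (r * t + INR (S N)) (1 + INR (S N)) x)).
  { intros t. unfold freal. rewrite (hseries_split (p * t + a) (1 / 2) (r * t) 1 x N) by lra. reflexivity. }
  assert (Ht : forall n, continuity_pt (fun t => hterm (p * t + a) (1 / 2) (r * t) 1 x n) w).
  { intros n. apply (continuity_pt_hterm (fun t => p * t + a) (fun t => r * t));
      [apply continuity_pt_affine|apply continuity_pt_linear| |lra].
    apply rpoch_neq0. auto. }
  apply (continuity_pt_plus (fun t => sum_f_R0 (fun n => hterm (p * t + a) (1 / 2) (r * t) 1 x n) N)).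
  { apply (continuity_pt_sum_f_R0 (fun n t => hterm (p * t + a) (1 / 2) (r * t) 1 x n)). auto. }
  apply (continuity_pt_mult (fun t => hterm (p * t + a) (1 / 2) (r * t) 1 x (S N))); [auto|].
  assert (HNp := pos_INR N). rewrite S_INR.
  apply (continuity_pt_hseries (fun t => p * t + a + (INR N + 1)) (fun t => r * t + (INR N + 1)));
    try lra.
  - apply (continuity_pt_ext (fun t => p * t + (a + (INR N + 1))));
      [intros; ring|apply continuity_pt_affine].
  - apply continuity_pt_affine.
Qed.

Definition residue_tail (s a x : R) (k : nat) : R :=
  hseries (a - INR k / s + INR (S k)) (1 / 2 + INR (S k)) 1 (1 + INR (S k)) x.

(** The limit of (r w + k) f(w) at w = -k/r, hence r times the residue, written with s = r/p because
    p w = -k/s there. The symbol (r w)_(k+1) has lost its vanishing last factor, which leaves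
    (-k)_k. *)
Definition residue (s a x : R) (k : nat) : R :=
  rpoch (a - INR k / s) (S k) * rpoch (1 / 2) (S k) / (rpoch (- INR k) k * rpoch 1 (S k))
  * x ^ (S k) * residue_tail s a x k.

Lemma is_lim_freal_pole (p r a x : R) (k : nat) :
  0 < p -> 0 < r -> 0 < x < 1 ->
  is_lim (fun w => (r * w + INR k) * freal p r a x w) (- INR k / r) (residue (r / p) a x k).
Proof.
  intros Hp Hr Hx. set (w0 := - INR k / r).
  assert (Hrw : r * w0 = - INR k) by (unfold w0; field; lra).
  assert (Hpw : p * w0 + a = a - INR k / (r / p)) by (unfold w0; field; lra).
  (* The continuous extension of (r t + k) f(t): the terms up to index k are regular at the pole and
     killed by the linear factor, while in the rest this factor cancels against (r t)_(k+1). *)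
  set (g := fun t => (r * t + INR k) * sum_f_R0 (fun n => hterm (p * t + a) (1 / 2) (r * t) 1 x n) k +
     rpoch (p * t + a) (S k) * rpoch (1 / 2) (S k) / (rpoch (r * t) k * rpoch 1 (S k))
      * x ^ (S k) *
     hseries (p * t + a + INR (S k)) (1 / 2 + INR (S k)) (r * t + INR (S k)) (1 + INR (S k)) x).
  assert (Hk := pos_INR k).
  assert (Hneg : forall n, (n <= k)%nat -> rpoch (r * w0) n <> 0).
  { intros n Hn. apply rpoch_neq0. intros j Hj. rewrite Hrw.
    assert (INR j < INR k) by (apply lt_INR; lia). lra. }
  assert (Hg : continuity_pt g w0).
  { unfold g.
    apply (continuity_pt_plus
      (fun t => (r * t + INR k) * sum_f_R0 (fun n => hterm (p * t + a) (1 / 2) (r * t) 1 x n) k)).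
    - apply (continuity_pt_mult (fun t => r * t + INR k)); [apply continuity_pt_affine|].
      apply (continuity_pt_sum_f_R0 (fun n t => hterm (p * t + a) (1 / 2) (r * t) 1 x n)).
      intros n Hn. apply (continuity_pt_hterm (fun t => p * t + a) (fun t => r * t));
      [apply continuity_pt_affine|apply continuity_pt_linear| |lra]. auto.
    - apply (continuity_pt_mult (fun t => rpoch (p * t + a) (S k) * rpoch (1 / 2) (S k)
                / (rpoch (r * t) k * rpoch 1 (S k)) * x ^ (S k))).
      + apply (continuity_pt_mult (fun t => rpoch (p * t + a) (S k) * rpoch (1 / 2) (S k)
                / (rpoch (r * t) k * rpoch 1 (S k))) (fun _ => x ^ (S k)));
          [|apply continuity_pt_cst].
        apply (continuity_pt_div (fun t => rpoch (p * t + a) (S k) * rpoch (1 / 2) (S k))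
                 (fun t => rpoch (r * t) k * rpoch 1 (S k))).
        * apply (continuity_pt_mult (fun t => rpoch (p * t + a) (S k)) (fun _ => rpoch (1 / 2) (S k)));
            [apply continuity_pt_rpoch, continuity_pt_affine|apply continuity_pt_cst].
        * apply (continuity_pt_mult (fun t => rpoch (r * t) k) (fun _ => rpoch 1 (S k)));
            [apply continuity_pt_rpoch, continuity_pt_linear|apply continuity_pt_cst].
        * apply Rmult_integral_contrapositive_currified; [auto|].
          generalize (rpoch_pos 1 (S k)); lra.
      + rewrite S_INR.
        apply (continuity_pt_hseries (fun t => p * t + a + (INR k + 1)) (fun t => r * t + (INR k + 1)));
          try lra.
        * apply (continuity_pt_ext (fun t => p * t + (a + (INR k + 1))));
            [intros; ring|apply continuity_pt_affine].
        * apply continuity_pt_affine. }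
  assert (Hval : g w0 = residue (r / p) a x k).
  { unfold g, residue, residue_tail. rewrite Hrw, Hpw.
    replace (- INR k + INR k) with 0 by ring.
    replace (- INR k + INR (S k)) with 1 by (rewrite S_INR; ring). ring. }
  rewrite <- Hval.
  apply (is_lim_ext_loc g); [|now apply is_lim_continuity].
  exists (mkposreal 1 Rlt_0_1). intros t Ht Hneq.
  assert (Hrt : r * t + INR k <> 0).
  { intros E. apply Hneq. unfold w0. apply Rmult_eq_reg_l with r; [|lra]. field_simplify; lra. }
  unfold freal, g. rewrite (hseries_split (p * t + a) (1 / 2) (r * t) 1 x k) by lra.
  rewrite Rmult_plus_distr_l. f_equal. rewrite <- Rmult_assoc. f_equal.
  unfold hterm.
  change (rpoch (r * t) (S k)) with (rpoch (r * t) k * (r * t + INR k)).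
  unfold Rdiv. rewrite !Rinv_mult.
  rewrite <- (Rmult_1_l (rpoch (p * t + a) (S k))) at 1.
  rewrite <- (Rinv_r (r * t + INR k) Hrt) at 1. ring.
Qed.

(** * Growth of the shift ratio *)

(** The domain condition and the regularity of each gamma factor can fail only where some affine
    function of w is an integer. So the shift equation holds in a punctured neighbourhood of every
    point, and limits at poles may be taken in it. *)
Lemma locally'_affine_not_int (r c w0 : R) :
  r <> 0 -> locally' w0 (fun w => forall n : Z, r * w + c <> IZR n).
Proof.
  intros Hr. set (y0 := r * w0 + c).
  assert (Har := Rabs_pos_lt r Hr).
  destruct (base_Int_part y0) as [H1 H2]. set (n0 := Int_part y0) in *.
  assert (Hd : exists d, 0 < d /\ d <= 1 /\ forall n : Z, IZR n <> y0 -> d <= Rabs (IZR n - y0)).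
  { destruct (Req_dec (IZR n0) y0) as [E|E].
    - exists 1. split; [lra|split; [lra|]]. intros n Hn. rewrite <- E, <- minus_IZR.
      rewrite <- abs_IZR. apply (IZR_le 1).
      assert (n <> n0) by (intros ->; auto). lia.
    - exists (Rmin (y0 - IZR n0) (IZR n0 + 1 - y0)).
      assert (IZR n0 < y0) by lra.
      split; [apply Rmin_glb_lt; lra|]. split.
      { unfold Rmin. destruct (Rle_dec (y0 - IZR n0) (IZR n0 + 1 - y0)); lra. }
      intros n _. destruct (Z_le_gt_dec n n0) as [Hn|Hn].
      + apply IZR_le in Hn. eapply Rle_trans; [apply Rmin_l|]. rewrite Rabs_left; lra.
      + assert (Hn' : (n0 + 1 <= n)%Z) by lia. apply IZR_le in Hn'. rewrite plus_IZR in Hn'.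
        eapply Rle_trans; [apply Rmin_r|]. rewrite Rabs_pos_eq; lra. }
  destruct Hd as (d & Hd0 & _ & Hd).
  assert (He : 0 < d / Rabs r) by (apply Rdiv_lt_0_compat; auto).
  exists (mkposreal _ He). intros w Hw Hne n E.
  change (Rabs (w - w0) < d / Rabs r) in Hw.
  assert (Hlt : Rabs (r * (w - w0)) < d).
  { rewrite Rabs_mult, Rmult_comm. apply Rmult_lt_reg_r with (/ Rabs r).
    - apply Rinv_0_lt_compat; auto.
    - rewrite Rmult_assoc, Rinv_r by lra. unfold Rdiv in Hw. lra. }
  assert (Hn : IZR n <> y0).
  { intros E'. apply Hne. apply Rmult_eq_reg_l with r; auto. unfold y0 in E'. lra. }
  specialize (Hd n Hn). unfold y0 in Hd. rewrite <- E in Hd.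
  replace (r * w + c - (r * w0 + c)) with (r * (w - w0)) in Hd by ring. lra.
Qed.

Lemma nonpos_int_re (w : R) (u : C) :
  nonpos_int (Cplus (RtoC w) u) -> exists n : Z, 1 * w + Re u = IZR n.
Proof.
  intros [k Hk]. exists (- Z.of_nat k)%Z.
  apply (f_equal Re) in Hk. destruct u as [a b]. simpl in Hk. simpl.
  rewrite opp_IZR, <- INR_IZR_INZ. lra.
Qed.

Lemma locally'_gamma_regular (us : list C) (c w0 : R) :
  locally' w0 (fun w => gamma_regular us (w + c)).
Proof.
  induction us as [|u us IH].
  - apply filter_forall. intros. constructor.
  - eapply filter_imp; [|apply (filter_and _ _ IH (locally'_affine_not_int 1 (c + Re u) w0 ltac:(lra)))].
    intros w [Hw1 Hw2]. constructor; [|exact Hw1].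
    intros H. destruct (nonpos_int_re _ _ H) as [n Hn]. apply (Hw2 n). lra.
Qed.

Lemma locally'_fdom (r c w0 : R) : 0 < r -> locally' w0 (fun w => fdom r (RtoC (w + c))).
Proof.
  intros Hr. eapply filter_imp; [|apply (locally'_affine_not_int r (r * c) w0); lra].
  intros w Hw [k Hk]. rewrite <- RtoC_mult in Hk. apply RtoC_inj in Hk.
  apply (Hw (- Z.of_nat k)%Z). rewrite opp_IZR, <- INR_IZR_INZ. lra.
Qed.

Lemma continuity_pt_absprod (l : list C) (w : R) : continuity_pt (absprod l) w.
Proof.
  unfold absprod. induction l as [|u l IH]; simpl.
  - apply continuity_pt_cst.
  - apply (continuity_pt_mult (fun t => Cmod (Cplus (RtoC t) u))); [|exact IH].
    unfold Cmod. destruct u as [a b].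
    apply (continuity_pt_comp
      (fun t => fst (Cplus (RtoC t) (a, b)) ^ 2 + snd (Cplus (RtoC t) (a, b)) ^ 2) sqrt).
    + apply derivable_continuous_pt. simpl. eexists. apply is_derive_Reals.
      auto_derive; auto.
    + apply continuity_pt_sqrt. apply Rplus_le_le_0_compat; apply pow2_ge_0.
Qed.

Lemma Cmod_shift_ge (w : R) (u : C) : Rabs w - Cmod u <= Cmod (Cplus (RtoC w) u) <= Rabs w + Cmod u.
Proof.
  split.
  - assert (H := Cmod_triangle (Cplus (RtoC w) u) (Copp u)).
    replace (Cplus (Cplus (RtoC w) u) (Copp u)) with (RtoC w) in H by ring.
    rewrite Cmod_opp, Cmod_R in H. lra.
  - rewrite <- Cmod_R. apply Cmod_triangle.
Qed.

Lemma absprod_pos (l : list C) (w : R) :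
  (forall u, In u l -> Cmod u < Rabs w) -> 0 < absprod l w.
Proof.
  unfold absprod. induction l as [|u l IH]; simpl; intros H; [lra|].
  apply Rmult_lt_0_compat; [|apply IH; auto].
  generalize (Cmod_shift_ge w u) (H u (or_introl eq_refl)). lra.
Qed.

Lemma exists_Cmod_bound (l : list C) : exists B, 0 < B /\ forall u, In u l -> Cmod u < B.
Proof.
  induction l as [|u l [B [HB IH]]].
  - exists 1. split; [lra|easy].
  - exists (Rmax B (Cmod u + 1)). split.
    + eapply Rlt_le_trans; [apply HB|apply Rmax_l].
    + intros v [<-|Hv].
      * eapply Rlt_le_trans; [|apply Rmax_r]. lra.
      * eapply Rlt_le_trans; [apply IH, Hv|apply Rmax_l].
Qed.

Lemma gamma_regular_large (us : list C) (B w : R) :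
  0 < B -> (forall u, In u us -> Cmod u < B) -> B <= w -> gamma_regular us w.
Proof.
  intros HB Hus Hw. apply Forall_forall. intros u Hu [k Hk].
  assert (E : u = RtoC (- INR k - w)).
  { rewrite RtoC_minus, <- Hk. ring. }
  specialize (Hus u Hu). rewrite E, Cmod_R in Hus.
  generalize (pos_INR k). intros. rewrite Rabs_left in Hus; lra.
Qed.

Lemma is_lim_seq_const_div_INR (c : R) : is_lim_seq (fun j => c / INR j) 0.
Proof.
  replace (Finite 0) with (Finite (c * 0)) by (f_equal; ring).
  apply is_lim_seq_mult'; [apply is_lim_seq_const|].
  apply (is_lim_seq_inv _ p_infty); [apply is_lim_seq_INR|discriminate].
Qed.

Lemma is_lim_seq_absprod (l : list C) (w0 sg : R) : Rabs sg = 1 ->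
  is_lim_seq (fun j => absprod l (w0 + sg * INR j) / INR j ^ length l) 1.
Proof.
  intros Hsg. unfold absprod. induction l as [|u l IH]; simpl.
  - apply (is_lim_seq_ext (fun _ => 1)); [intros; field|apply is_lim_seq_const].
  - apply (is_lim_seq_ext (fun j => Cmod (Cplus (RtoC (w0 + sg * INR j)) u) / INR j *
      (fold_right Rmult 1 (map (fun u0 => Cmod (Cplus (RtoC (w0 + sg * INR j)) u0)) l)
        / INR j ^ length l))).
    { intros j. unfold Rdiv. rewrite Rinv_mult. ring. }
    replace (Finite 1) with (Finite (1 * 1)) by (f_equal; ring).
    apply is_lim_seq_mult'; [|exact IH].
    set (c := Cmod (Cplus (RtoC w0) u)).
    apply (is_lim_seq_le_le_loc (fun j => 1 - c / INR j) _ (fun j => 1 + c / INR j)).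
    + exists 1%nat. intros j Hj. assert (Hj' : 0 < INR j) by (apply lt_0_INR; lia).
      replace (Cplus (RtoC (w0 + sg * INR j)) u)
        with (Cplus (RtoC (sg * INR j)) (Cplus (RtoC w0) u)) by (rewrite RtoC_plus; ring).
      assert (H := Cmod_shift_ge (sg * INR j) (Cplus (RtoC w0) u)). fold c in H.
      rewrite Rabs_mult, Hsg, Rabs_pos_eq in H by lra.
      split; apply Rmult_le_reg_r with (INR j); auto; field_simplify; lra.
    + replace (Finite 1) with (Finite (1 - 0)) by (f_equal; ring).
      apply is_lim_seq_minus'; [apply is_lim_seq_const|apply is_lim_seq_const_div_INR].
    + replace (Finite 1) with (Finite (1 + 0)) by (f_equal; ring).
      apply is_lim_seq_plus'; [apply is_lim_seq_const|apply is_lim_seq_const_div_INR].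
Qed.

(** Otherwise the sequence would eventually decay geometrically. The limit ranges over [Rbar] so
    that the cases of unequal degrees of U and V are covered at once. *)
Lemma is_lim_seq_ratio_ge1 (u : nat -> R) (c : R) (th : Rbar) :
  0 < c -> (forall j, c <= u j) -> is_lim_seq (fun j => u (S j) / u j) th -> Rbar_le 1 th.
Proof.
  intros Hc Hu Hl.
  destruct (Rbar_le_lt_dec 1 th) as [H|H]; [exact H|exfalso].
  assert (Hq : exists q, 0 < q < 1 /\ Rbar_lt th q).
  { destruct th as [t| |]; simpl in H.
    - exists (Rmax (1 / 2) ((1 + t) / 2)). simpl. unfold Rmax.
      destruct (Rle_dec (1 / 2) ((1 + t) / 2)); lra.
    - easy.
    - exists (1 / 2). simpl. lra. }
  destruct Hq as (q & Hq & Hthq).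
  assert (Hev : eventually (fun j => u (S j) / u j < q)).
  { apply is_lim_seq_spec in Hl. destruct th as [t| |]; simpl in *; try easy.
    - assert (He : 0 < q - t) by lra. destruct (Hl (mkposreal _ He)) as [N HN].
      exists N. intros n Hn. specialize (HN n Hn). simpl in HN. split_Rabs; lra. }
  destruct Hev as [N HN].
  assert (Hg : forall j, u (N + j)%nat <= u N * q ^ j).
  { induction j as [|j IH].
    - rewrite Nat.add_0_r. simpl. lra.
    - rewrite Nat.add_succ_r. simpl.
      assert (H1 := HN (N + j)%nat ltac:(lia)). assert (H2 := Hu (N + j)%nat).
      apply (Rmult_lt_compat_r (u (N + j)%nat)) in H1; [|lra].
      unfold Rdiv in H1. rewrite Rmult_assoc, Rinv_l in H1 by lra. nra. }
  assert (Hz : is_lim_seq (fun j => u N * q ^ j) (u N * 0)).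
  { apply is_lim_seq_mult'; [apply is_lim_seq_const|].
    apply is_lim_seq_geom. rewrite Rabs_pos_eq; lra. }
  assert (Hle : Rbar_le c (u N * 0)).
  { apply (is_lim_seq_le (fun _ => c) (fun j => u N * q ^ j)); auto using is_lim_seq_const.
    intros j. eapply Rle_trans; [apply Hu|apply Hg]. }
  simpl in Hle. lra.
Qed.

Lemma is_lim_seq_ratio_le1 (u : nat -> R) (B : R) (th : Rbar) :
  (forall j, 0 < u j <= B) -> is_lim_seq (fun j => u (S j) / u j) th -> Rbar_le th 1.
Proof.
  intros Hu Hl.
  destruct (Rbar_le_lt_dec th 1) as [H|H]; [exact H|exfalso].
  assert (Hq : exists q, 1 < q /\ Rbar_lt q th).
  { destruct th as [t| |]; simpl in H.
    - exists ((1 + t) / 2). simpl. lra.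
    - exists 2. simpl. lra.
    - easy. }
  destruct Hq as (q & Hq & Hthq).
  assert (Hev : eventually (fun j => q < u (S j) / u j)).
  { apply is_lim_seq_spec in Hl. destruct th as [t| |]; simpl in *; try easy.
    - assert (He : 0 < t - q) by lra. destruct (Hl (mkposreal _ He)) as [N HN].
      exists N. intros n Hn. specialize (HN n Hn). simpl in HN. split_Rabs; lra. }
  destruct Hev as [N HN].
  assert (Hg : forall j, u N * q ^ j <= u (N + j)%nat).
  { induction j as [|j IH].
    - rewrite Nat.add_0_r. simpl. lra.
    - rewrite Nat.add_succ_r. simpl.
      assert (H1 := HN (N + j)%nat ltac:(lia)). assert (H2 := Hu (N + j)%nat).
      apply (Rmult_lt_compat_r (u (N + j)%nat)) in H1; [|lra].
      unfold Rdiv in H1. rewrite Rmult_assoc, Rinv_l in H1 by lra. nra. }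
  assert (HuN := Hu N).
  assert (Hz : is_lim_seq (fun j => q ^ j) p_infty) by now apply is_lim_seq_geom_p.
  apply is_lim_seq_spec in Hz. destruct (Hz (B / u N)) as [M HM].
  specialize (HM M (Nat.le_refl _)). specialize (Hg M). specialize (Hu (N + M)%nat).
  apply (Rmult_lt_compat_l (u N)) in HM; [|lra].
  replace (u N * (B / u N)) with B in HM by (field; lra). lra.
Qed.

Definition shift_ratio (lam : R) (us vs : list C) (w : R) : R :=
  lam * absprod us w / absprod vs w.

(** The limit of |e^L U/V| according to the degrees m of U and n of V; equating it to [Finite 1]
    expresses both m = n and |e^L| = 1. *)
Definition shift_ratio_limit (lam : R) (m n : nat) : Rbar :=
  if Nat.ltb m n then Finite 0 else if Nat.ltb n m then p_infty else Finite lam.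

(** The limit depends neither on [w0] nor on the direction [sg]. This is the bridge from the right
    end of the axis, where f is bounded, to the left end, where the poles lie. *)
Lemma is_lim_seq_shift_ratio (lam : R) (us vs : list C) (w0 sg : R) :
  0 < lam -> Rabs sg = 1 ->
  is_lim_seq (fun j => shift_ratio lam us vs (w0 + sg * INR j))
    (shift_ratio_limit lam (length us) (length vs)).
Proof.
  intros Hlam Hsg. set (m := length us). set (n := length vs).
  assert (HU := is_lim_seq_absprod us w0 sg Hsg).
  assert (HV := is_lim_seq_absprod vs w0 sg Hsg).
  assert (HUV : is_lim_seq (fun j => lam * (absprod us (w0 + sg * INR j) / INR j ^ m /
             (absprod vs (w0 + sg * INR j) / INR j ^ n))) lam).
  { replace (Finite lam) with (Finite (lam * (1 / 1))) by (f_equal; field).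
    apply is_lim_seq_mult'; [apply is_lim_seq_const|].
    apply is_lim_seq_div'; auto. }
  assert (Hinf : forall d, is_lim_seq (fun j => INR j ^ S d) p_infty).
  { intros d. apply (is_lim_seq_le_p_loc INR); [|apply is_lim_seq_INR].
    exists 1%nat. intros j Hj. assert (H1 : 1 <= INR j) by (apply (le_INR 1); lia).
    simpl. assert (1 <= INR j ^ d) by now apply pow_R1_Rle. nra. }
  assert (Hext : forall L, is_lim_seq (fun j => lam * (absprod us (w0 + sg * INR j) / INR j ^ m /
             (absprod vs (w0 + sg * INR j) / INR j ^ n)) * (INR j ^ m / INR j ^ n)) L ->
             is_lim_seq (fun j => shift_ratio lam us vs (w0 + sg * INR j)) L).
  { intros L. apply is_lim_seq_ext_loc. exists 1%nat. intros j Hj. unfold shift_ratio, Rdiv.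
    assert (Hj' : 0 < INR j) by (apply lt_0_INR; lia).
    rewrite Rinv_mult, Rinv_inv.
    assert (H1 : INR j ^ m <> 0) by (apply pow_nonzero; lra).
    assert (H2 : INR j ^ n <> 0) by (apply pow_nonzero; lra).
    generalize (/ absprod vs (w0 + sg * INR j)). intros iv. field. auto. }
  apply Hext. unfold shift_ratio_limit.
  destruct (Nat.ltb_spec m n) as [Hmn|Hmn]; [|destruct (Nat.ltb_spec n m) as [Hnm|Hnm]].
  - replace (Finite 0) with (Finite (lam * 0)) by (f_equal; ring).
    apply is_lim_seq_mult'; [exact HUV|].
    apply (is_lim_seq_ext_loc (fun j => / INR j ^ S (n - m - 1))).
    + exists 1%nat. intros j Hj. assert (Hj' : 0 < INR j) by (apply lt_0_INR; lia).
      replace n with (m + S (n - m - 1))%nat at 2 by lia. rewrite pow_add.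
      field. split; apply pow_nonzero; lra.
    + apply (is_lim_seq_inv _ p_infty); [apply Hinf|discriminate].
  - apply (is_lim_seq_mult _ _ lam p_infty).
    + exact HUV.
    + apply (is_lim_seq_ext_loc (fun j => INR j ^ S (m - n - 1))); [|apply Hinf].
      exists 1%nat. intros j Hj. assert (Hj' : 0 < INR j) by (apply lt_0_INR; lia).
      replace m with (n + S (m - n - 1))%nat at 2 by lia. rewrite pow_add.
      field. apply pow_nonzero; lra.
    + apply is_Rbar_mult_sym. now apply is_Rbar_mult_p_infty_pos.
  - replace m with n by lia.
    replace (Finite lam) with (Finite (lam * 1)) by (f_equal; ring).
    apply is_lim_seq_mult'.
    + replace m with n in HUV by lia. exact HUV.
    + apply (is_lim_seq_ext_loc (fun _ => 1)); [|apply is_lim_seq_const].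
      exists 1%nat. intros j Hj. assert (Hj' : 0 < INR j) by (apply lt_0_INR; lia).
      field. apply pow_nonzero; lra.
Qed.

(** With 0 < p w + a <= r w and 1/2 <= 1, every coefficient of the series lies between 0 and 1, so f
    is squeezed between its first term and the geometric series. *)
Lemma freal_bounds (p r a x w : R) :
  0 < x < 1 -> 0 < p * w + a <= r * w -> 1 <= freal p r a x w <= / (1 - x).
Proof.
  intros Hx Hw. unfold freal, hseries.
  assert (Hex : ex_series (hterm (p * w + a) (1 / 2) (r * w) 1 x)) by (apply ex_series_hterm; lra).
  assert (Hpos : forall n, 0 < hterm (p * w + a) (1 / 2) (r * w) 1 x n)
    by (intros n; apply hterm_pos; lra).
  split.
  - rewrite Series_incr_1 by exact Hex.
    assert (0 <= Series (fun k => hterm (p * w + a) (1 / 2) (r * w) 1 x (S k))).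
    { rewrite <- (Rmult_0_l (Series (fun _ => 0))), <- Series_scal_l.
      apply Series_le.
      - intros n. generalize (Hpos (S n)). lra.
      - now apply ex_series_incr_1 in Hex. }
    unfold hterm at 1. simpl. lra.
  - rewrite <- Series_geom by (rewrite Rabs_pos_eq; lra).
    apply Series_le; [|apply ex_series_geom; rewrite Rabs_pos_eq; lra].
    intros n. split; [generalize (Hpos n); lra|].
    unfold hterm. rewrite <- (Rmult_1_l (x ^ n)) at 2.
    apply Rmult_le_compat_r; [left; apply pow_lt; lra|].
    assert (H1 : 0 < rpoch (r * w) n) by (apply rpoch_pos; lra).
    assert (H2 : 0 < rpoch 1 n) by (apply rpoch_pos; lra).
    assert (H12 : 0 < rpoch (r * w) n * rpoch 1 n) by now apply Rmult_lt_0_compat.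
    apply (Rdiv_le_1 _ _ H12).
    apply Rmult_le_compat; try (left; apply rpoch_pos; lra); apply rpoch_le; lra.
Qed.

(** * Recurrence and growth of the residues *)

Definition shift_equation (lam : R) (us vs : list C) (p r a x : R) : Prop :=
  forall w : R,
    fdom r (RtoC w) -> fdom r (RtoC (w + 1)) ->
    gamma_regular us w -> gamma_regular us (w + 1) ->
    absprod vs w * Rabs (freal p r a x (w + 1)) =
    lam * absprod us w * Rabs (freal p r a x w).

Lemma shift_equation_balanced (lam : R) (us vs : list C) (p r a x : R) :
  0 < lam -> 0 < p < r -> 0 < x < 1 -> shift_equation lam us vs p r a x ->
  shift_ratio_limit lam (length us) (length vs) = Finite 1.
Proof.
  intros Hlam Hpr Hx Heq.
  destruct (exists_Cmod_bound (us ++ vs)) as (B & HB & HBu).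
  (* The summands ensure in turn that w exceeds every |u_i| and |v_j|, that p w + a is positive, and
     that p w + a <= r w. *)
  set (w0 := B + Rabs a / p + Rabs a / (r - p) + 1).
  assert (Ha := Rabs_pos a).
  assert (Hap : 0 <= Rabs a / p) by (apply Rdiv_le_0_compat; lra).
  assert (Hrp : 0 <= Rabs a / (r - p)) by (apply Rdiv_le_0_compat; lra).
  assert (Hw : forall w, w0 <= w -> 0 < p * w + a <= r * w).
  { intros w Hw. unfold w0 in Hw. split.
    - assert (p * (Rabs a / p + 1) <= p * w) by (apply Rmult_le_compat_l; lra).
      replace (p * (Rabs a / p + 1)) with (Rabs a + p) in H by (field; lra).
      split_Rabs; lra.
    - assert ((r - p) * (Rabs a / (r - p)) <= (r - p) * w) by (apply Rmult_le_compat_l; lra).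
      replace ((r - p) * (Rabs a / (r - p))) with (Rabs a) in H by (field; lra).
      split_Rabs; lra. }
  set (t := fun j => freal p r a x (w0 + 1 * INR j)).
  assert (Ht : forall j, 1 <= t j <= / (1 - x)).
  { intros j. apply freal_bounds; auto. apply Hw. generalize (pos_INR j); lra. }
  assert (Hfd : forall w, w0 <= w -> fdom r (RtoC w)).
  { intros w Hw' [k Hk]. rewrite <- RtoC_mult in Hk. apply RtoC_inj in Hk.
    generalize (pos_INR k) (Hw w Hw'). lra. }
  assert (Hlim : is_lim_seq (fun j => t (S j) / t j) (shift_ratio_limit lam (length us) (length vs))).
  { apply (is_lim_seq_ext (fun j => shift_ratio lam us vs (w0 + 1 * INR j)));
      [|apply is_lim_seq_shift_ratio; auto; apply Rabs_R1].
    intros j. assert (Hj := pos_INR j).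
    assert (E := Heq (w0 + 1 * INR j) ltac:(apply Hfd; lra) ltac:(apply Hfd; lra)).
    assert (Hus : forall u, In u us -> Cmod u < B) by (intros; apply HBu, in_or_app; auto).
    specialize (E ltac:(apply (gamma_regular_large us B); auto; unfold w0; lra)).
    specialize (E ltac:(apply (gamma_regular_large us B); auto; unfold w0; lra)).
    replace (w0 + 1 * INR j + 1) with (w0 + 1 * INR (S j)) in E by (rewrite S_INR; ring).
    fold (t j) in E. fold (t (S j)) in E.
    assert (H1 := Ht j). assert (H2 := Ht (S j)).
    rewrite !Rabs_pos_eq in E by lra.
    assert (HV : 0 < absprod vs (w0 + 1 * INR j)).
    { apply absprod_pos. intros v Hv. apply Rlt_le_trans with B; [apply HBu, in_or_app; auto|].
      rewrite Rabs_pos_eq; unfold w0; lra. }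
    unfold shift_ratio.
    apply Rmult_eq_reg_r with (absprod vs (w0 + 1 * INR j) * t j); [|nra].
    transitivity (lam * absprod us (w0 + 1 * INR j) * t j); [field; lra|].
    rewrite <- E. field. lra. }
  apply Rbar_le_antisym.
  - apply (is_lim_seq_ratio_le1 t (/ (1 - x))); auto. intros j. generalize (Ht j). lra.
  - apply (is_lim_seq_ratio_ge1 t 1); auto; [lra|]. intros j. generalize (Ht j). lra.
Qed.

Lemma is_lim_mult_finite (f g : R -> R) (x l m : R) :
  is_lim f x l -> is_lim g x m -> is_lim (fun t => f t * g t) x (l * m).
Proof. intros Hf Hg. exact (is_lim_mult f g x l m Hf Hg I). Qed.

(** The shift equation is multiplied by r (w+1) + k and w tends to [w1]. On the left w + 1 runs into
    the pole -k/r. On the right [w1] is the pole of index k + r when r is a natural number;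
    otherwise f is continuous at [w1] and the right-hand limit is 0. *)
Lemma residue_recurrence (lam : R) (us vs : list C) (p r a x : R) (k : nat) :
  0 < p -> 0 < r -> 0 < x < 1 -> shift_equation lam us vs p r a x ->
  let w1 := - INR k / r - 1 in
  (forall r' : nat, r = INR r' ->
     absprod vs w1 * Rabs (residue (r / p) a x k) =
     lam * absprod us w1 * Rabs (residue (r / p) a x (k + r'))) /\
  ((forall r' : nat, r <> INR r') -> absprod vs w1 * Rabs (residue (r / p) a x k) = 0).
Proof.
  intros Hp Hr Hx Heq w1.
  assert (HL : is_lim (fun w => absprod vs w * Rabs ((r * (w + 1) + INR k) * freal p r a x (w + 1)))
                 w1 (absprod vs w1 * Rabs (residue (r / p) a x k))).
  { apply is_lim_mult_finite; [apply is_lim_continuity, continuity_pt_absprod|].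
    apply (is_lim_Rabs _ _ (residue (r / p) a x k)).
    apply (is_lim_ext (fun w => (fun y => (r * y + INR k) * freal p r a x y) (1 * w + 1))).
    { intros w. now rewrite Rmult_1_l. }
    apply (is_lim_comp_lin (fun y => (r * y + INR k) * freal p r a x y) 1 1 w1); [|lra].
    replace (Rbar_plus (Rbar_mult 1 w1) 1) with (Finite (- INR k / r))
      by (simpl; f_equal; unfold w1; ring).
    now apply is_lim_freal_pole. }
  assert (HU : is_lim (fun w => lam * absprod us w) w1 (lam * absprod us w1)).
  { apply is_lim_mult_finite; [apply is_lim_const|apply is_lim_continuity, continuity_pt_absprod]. }
  assert (Hev : Rbar_locally' w1 (fun w =>
     absprod vs w * Rabs ((r * (w + 1) + INR k) * freal p r a x (w + 1)) =
     lam * absprod us w * Rabs ((r * w + (r + INR k)) * freal p r a x w))).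
  { change (locally' w1 (fun w =>
     absprod vs w * Rabs ((r * (w + 1) + INR k) * freal p r a x (w + 1)) =
     lam * absprod us w * Rabs ((r * w + (r + INR k)) * freal p r a x w))).
    eapply filter_imp;
      [|apply (filter_and _ _
           (filter_and _ _ (locally'_fdom r 0 w1 Hr) (locally'_fdom r 1 w1 Hr))
           (filter_and _ _ (locally'_gamma_regular us 0 w1) (locally'_gamma_regular us 1 w1)))].
    intros w [[H1 H2] [H3 H4]]. rewrite Rplus_0_r in H1, H3.
    specialize (Heq w H1 H2 H3 H4).
    rewrite !Rabs_mult.
    replace (r * (w + 1) + INR k) with (r * w + (r + INR k)) by ring.
    transitivity (Rabs (r * w + (r + INR k)) * (absprod vs w * Rabs (freal p r a x (w + 1))));
      [ring|]. rewrite Heq. ring. }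
  apply (is_lim_ext_loc _ _ _ _ Hev) in HL.
  assert (Huniq : forall l : R, is_lim (fun w => (r * w + (r + INR k)) * freal p r a x w) w1 l ->
            absprod vs w1 * Rabs (residue (r / p) a x k) = lam * absprod us w1 * Rabs l).
  { intros l Hl.
    assert (HR := is_lim_mult_finite _ _ _ _ _ HU (is_lim_Rabs _ _ (Finite l) Hl)).
    apply is_lim_unique in HL, HR. rewrite HL in HR. injection HR. auto. }
  split.
  - intros r' Hr'. apply Huniq.
    assert (H := is_lim_freal_pole p r a x (k + r') Hp Hr Hx).
    replace (- INR (k + r') / r) with w1 in H
      by (rewrite plus_INR, <- Hr'; unfold w1; field; lra).
    apply (is_lim_ext (fun w => (r * w + INR (k + r')) * freal p r a x w)); auto.
    intros w. rewrite plus_INR, Hr'. ring.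
  - intros Hno. rewrite (Huniq 0); [rewrite Rabs_R0; ring|].
    assert (Hc : continuity_pt (freal p r a x) w1).
    { apply continuity_pt_freal; auto. intros j E.
      assert (E' : r = INR j - INR k).
      { unfold w1 in E. replace (r * (- INR k / r - 1)) with (- INR k - r) in E by (field; lra). lra. }
      assert (Hjk : (k <= j)%nat).
      { apply INR_le. lra. }
      apply (Hno (j - k)%nat). rewrite minus_INR; auto. }
    replace (Finite 0) with (Finite ((r * w1 + (r + INR k)) * freal p r a x w1)).
    + apply is_lim_mult_finite; [|now apply is_lim_continuity].
      apply (is_lim_continuity (fun w => r * w + (r + INR k))), continuity_pt_affine.
    + f_equal. replace (r * w1 + (r + INR k)) with 0 by (unfold w1; field; lra). ring.
Qed.

(** * Comparison of the tail with the binomial series *)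

Lemma rpoch_S_left (y : R) (n : nat) : rpoch y (S n) = y * rpoch (y + 1) n.
Proof.
  change (S n) with (1 + n)%nat. rewrite rpoch_add. simpl. ring.
Qed.

Lemma hterm_0 (A B C D x : R) : hterm A B C D x 0 = 1.
Proof. unfold hterm. simpl. field. Qed.

(** The series of (1-x)^(-A). It is never identified with a real power: its behaviour under integer
    shifts of A suffices. *)
Definition binom_series (A x : R) : R := hseries A 1 1 1 x.

(** Multiplication by 1 - x acts on the coefficients (A+1)_n / n! by Pascal's rule. *)
Lemma binom_series_succ (A x : R) :
  0 < x < 1 -> binom_series (A + 1) x = binom_series A x / (1 - x).
Proof.
  intros Hx. unfold binom_series, hseries.
  assert (H0 : forall A, ex_series (hterm A 1 1 1 x)) by (intros; apply ex_series_hterm; lra).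
  assert (E : Series (hterm A 1 1 1 x) = (1 - x) * Series (hterm (A + 1) 1 1 1 x)).
  { rewrite (Series_incr_1 (hterm A 1 1 1 x)) by auto.
    rewrite Rmult_minus_distr_r, Rmult_1_l, (Series_incr_1 (hterm (A + 1) 1 1 1 x)) at 1 by auto.
    rewrite <- Series_scal_l.
    rewrite (Series_ext (fun k => hterm A 1 1 1 x (S k))
       (fun k => hterm (A + 1) 1 1 1 x (S k) - x * hterm (A + 1) 1 1 1 x k)).
    - rewrite Series_minus.
      + rewrite !hterm_0. ring.
      + apply (ex_series_incr_1 (hterm (A + 1) 1 1 1 x)); auto.
      + apply (ex_series_scal (V := R_NormedModule) x (hterm (A + 1) 1 1 1 x)); auto.
    - intros n. unfold hterm. rewrite (rpoch_S_left A).
      change (rpoch (A + 1) (S n)) with (rpoch (A + 1) n * (A + 1 + INR n)).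
      change (rpoch 1 (S n)) with (rpoch 1 n * (1 + INR n)).
      assert (H1 := rpoch_pos 1 n Rlt_0_1). assert (H2 := pos_INR n).
      simpl pow. field. lra. }
  rewrite E. field. lra.
Qed.

Lemma binom_series_add (A x : R) (n : nat) :
  0 < x < 1 -> binom_series (A + INR n) x = binom_series A x / (1 - x) ^ n.
Proof.
  intros Hx. induction n as [|n IH].
  - simpl. rewrite Rplus_0_r. field.
  - rewrite S_INR, <- Rplus_assoc, binom_series_succ, IH by auto.
    simpl. field. split; [apply pow_nonzero|]; lra.
Qed.

Lemma hseries_gt1 (A B C D x : R) :
  0 < A -> 0 < B -> 0 < C -> 0 < D -> 0 < x < 1 -> 1 < hseries A B C D x.
Proof.
  intros HA HB HC HD Hx. unfold hseries.
  assert (Hex := ex_series_hterm A B C D x HB HD Hx).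
  assert (Hex1 : ex_series (fun k => hterm A B C D x (S k))) by now apply ex_series_incr_1 in Hex.
  assert (Hex2 : ex_series (fun k => hterm A B C D x (S (S k))))
    by (apply (ex_series_incr_1 (fun k => hterm A B C D x (S k))); auto).
  rewrite Series_incr_1, (Series_incr_1 (fun k => hterm A B C D x (S k))) by auto.
  assert (Hp := hterm_pos A B C D x 1 HA HB HC HD (proj1 Hx)).
  assert (0 <= Series (fun k => hterm A B C D x (S (S k)))).
  { rewrite <- (Rmult_0_l (Series (fun _ => 0))), <- Series_scal_l.
    apply Series_le; auto. intros n.
    generalize (hterm_pos A B C D x (S (S n)) HA HB HC HD (proj1 Hx)). lra. }
  rewrite hterm_0. lra.
Qed.

(** The lower bound is 1/(n+1), written as a quotient of Pochhammer symbols so that inserting it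
    into the series gives a hypergeometric series again. *)
Lemma rpoch_half_ratio (D : R) (n : nat) : 1 <= D ->
  rpoch 1 n / rpoch 2 n <= rpoch (D - 1 / 2) n / rpoch D n <= 1.
Proof.
  intros HD. induction n as [|n [IH1 IH2]]; simpl; [lra|].
  assert (Hn := pos_INR n).
  assert (H1 := rpoch_pos 1 n Rlt_0_1). assert (H2 := rpoch_pos 2 n Rlt_0_2).
  assert (H3 := rpoch_pos D n ltac:(lra)). assert (H4 := rpoch_pos (D - 1 / 2) n ltac:(lra)).
  replace (rpoch 1 n * (1 + INR n) / (rpoch 2 n * (2 + INR n)))
    with (rpoch 1 n / rpoch 2 n * ((1 + INR n) / (2 + INR n))) by (field; lra).
  replace (rpoch (D - 1 / 2) n * (D - 1 / 2 + INR n) / (rpoch D n * (D + INR n)))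
    with (rpoch (D - 1 / 2) n / rpoch D n * ((D - 1 / 2 + INR n) / (D + INR n))) by (field; lra).
  assert (H5 : 0 < rpoch 1 n / rpoch 2 n) by (apply Rdiv_lt_0_compat; lra).
  assert (H6 : (1 + INR n) / (2 + INR n) <= (D - 1 / 2 + INR n) / (D + INR n)).
  { apply Rmult_le_reg_r with ((2 + INR n) * (D + INR n)); [apply Rmult_lt_0_compat; lra|].
    replace ((1 + INR n) / (2 + INR n) * ((2 + INR n) * (D + INR n)))
      with ((1 + INR n) * (D + INR n)) by (field; lra).
    replace ((D - 1 / 2 + INR n) / (D + INR n) * ((2 + INR n) * (D + INR n)))
      with ((D - 1 / 2 + INR n) * (2 + INR n)) by (field; lra).
    nra. }
  assert (H7 : (D - 1 / 2 + INR n) / (D + INR n) <= 1).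
  { assert (Hd : 0 < D + INR n) by lra. apply (Rdiv_le_1 _ _ Hd). lra. }
  assert (H8 : 0 < (1 + INR n) / (2 + INR n)) by (apply Rdiv_lt_0_compat; lra).
  split.
  - apply Rmult_le_compat; lra.
  - apply Rle_trans with (1 * 1); [apply Rmult_le_compat; lra|lra].
Qed.

(* The two Pochhammer symbols half a unit apart have a ratio between [1/(m+1)] and [1], so only
   a power of [A] is lost against the binomial series. *)
Lemma hseries_half_bounds (A D x : R) : 1 < A -> 1 <= D -> 0 < x < 1 ->
  (binom_series (A - 1) x - 1) / (A - 1) <= hseries A (D - 1 / 2) 1 D x <= binom_series A x.
Proof.
  intros HA HD Hx. unfold binom_series.
  assert (Hterm : forall B D' m, hterm A B 1 D' x m = rpoch A m / rpoch 1 m * x ^ m * (rpoch B m / rpoch D' m)).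
  { intros. unfold hterm, Rdiv. rewrite Rinv_mult. ring. }
  assert (Hc : forall m, 0 < rpoch A m / rpoch 1 m * x ^ m).
  { intros m. apply Rmult_lt_0_compat; [|apply pow_lt; lra].
    apply Rdiv_lt_0_compat; apply rpoch_pos; lra. }
  split.
  (* With 1/(m+1) in place of the ratio the series can be summed: (A-1) x times it is the binomial
     series for A-1 without its first term. The factor x < 1 is then given away. *)
  - apply Rle_trans with (hseries A 1 1 2 x).
    + unfold hseries.
      rewrite (Series_incr_1 (hterm (A - 1) 1 1 1 x)) by (apply ex_series_hterm; lra).
      rewrite (Series_ext (fun k => hterm (A - 1) 1 1 1 x (S k))
                 (fun k => (A - 1) * x * hterm A 1 1 2 x k)).
      * rewrite Series_scal_l. rewrite hterm_0.
        assert (0 <= Series (hterm A 1 1 2 x)).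
        { generalize (hseries_gt1 A 1 1 2 x). unfold hseries. lra. }
        replace ((1 + (A - 1) * x * Series (hterm A 1 1 2 x) - 1) / (A - 1))
          with (x * Series (hterm A 1 1 2 x)) by (field; lra).
        nra.
      * intros m. unfold hterm. rewrite !rpoch_S_left.
        replace (A - 1 + 1) with A by ring. replace (1 + 1) with 2 by ring.
        assert (H1 := rpoch_pos 1 m Rlt_0_1). assert (H2 := rpoch_pos 2 m Rlt_0_2).
        simpl pow. field. lra.
    + unfold hseries. apply Series_le; [|apply ex_series_hterm; lra].
      intros m. rewrite !Hterm. destruct (rpoch_half_ratio D m HD) as [H1 _].
      split.
      * apply Rmult_le_pos; [left; auto|]. left; apply Rdiv_lt_0_compat; apply rpoch_pos; lra.
      * apply Rmult_le_compat_l; [left; auto|]. exact H1.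
  - unfold hseries. apply Series_le; [|apply ex_series_hterm; lra].
    intros m. rewrite !Hterm. destruct (rpoch_half_ratio D m HD) as [_ H1].
    split.
    + apply Rmult_le_pos; [left; auto|]. left; apply Rdiv_lt_0_compat; apply rpoch_pos; lra.
    + apply Rmult_le_compat_l; [left; auto|].
      replace (rpoch 1 m / rpoch 1 m) with 1; [exact H1|].
      assert (H2 := rpoch_pos 1 m Rlt_0_1). field. lra.
Qed.

Lemma is_lim_seq_rpoch (c y : R) (n : nat) :
  is_lim_seq (fun j => rpoch (c + y * INR j) n / INR j ^ n) (y ^ n).
Proof.
  induction n as [|n IH]; simpl.
  - apply (is_lim_seq_ext (fun _ => 1)); [intros; field|apply is_lim_seq_const].
  - apply (is_lim_seq_ext (fun j => (c + y * INR j + INR n) / INR j * (rpoch (c + y * INR j) n / INR j ^ n))).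
    { intros j. unfold Rdiv. rewrite Rinv_mult. ring. }
    apply is_lim_seq_mult'; [|exact IH].
    apply (is_lim_seq_ext_loc (fun j => y + (c + INR n) / INR j)).
    + exists 1%nat. intros j Hj. assert (0 < INR j) by (apply lt_0_INR; lia). field. lra.
    + replace (Finite y) with (Finite (y + 0)) by (f_equal; ring).
      apply is_lim_seq_plus'; [apply is_lim_seq_const|apply is_lim_seq_const_div_INR].
Qed.

Lemma is_lim_seq_ratio_step (b : nat -> R) (s : nat) :
  (forall i, 0 < b i) -> is_lim_seq (fun i => b (S i) / b i) 1 ->
  is_lim_seq (fun i => b (i + s)%nat / b i) 1.
Proof.
  intros Hb Hl. induction s as [|s IH].
  - apply (is_lim_seq_ext (fun _ => 1)); [|apply is_lim_seq_const].
    intros i. rewrite Nat.add_0_r. specialize (Hb i). field. lra.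
  - apply (is_lim_seq_ext (fun i => b (S (i + s)) / b (i + s)%nat * (b (i + s)%nat / b i))).
    { intros i. rewrite Nat.add_succ_r. generalize (Hb i) (Hb (i + s)%nat). intros. field. lra. }
    replace (Finite 1) with (Finite (1 * 1)) by (f_equal; ring).
    apply is_lim_seq_mult'; [|exact IH].
    apply (is_lim_seq_incr_n (fun i => b (S i) / b i) s). exact Hl.
Qed.

Lemma Rabs_rpoch_neg (k : nat) : Rabs (rpoch (- INR k) k) = rpoch 1 k.
Proof.
  induction k as [|k IH]; [simpl; apply Rabs_R1|].
  rewrite rpoch_S_left, Rabs_mult.
  replace (- INR (S k) + 1) with (- INR k) by (rewrite S_INR; ring).
  rewrite IH, Rabs_Ropp, Rabs_pos_eq by apply pos_INR. simpl rpoch. rewrite S_INR. ring.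
Qed.

(** * The critical equation *)

Definition residue_coef (s a x : R) (k : nat) : R :=
  Rabs (rpoch (a - INR k / s) (S k)) * rpoch (1 / 2) (S k) / (rpoch 1 k * rpoch 1 (S k)) * x ^ (S k).

(** When k grows by r (N+1) = r s, the base a - k/s drops by the integer r while the length grows by
    r s. The new symbol thus extends the old one by r factors below and r N factors above, which are
    the two absolute values here. *)
Definition residue_coef_ratio (s a x : R) (N r k : nat) : R :=
  Rabs (rpoch (a - INR k / s - INR r) r) * Rabs (rpoch (a - INR k / s + INR (S k)) (r * N))
  * rpoch (1 / 2 + INR (S k)) (r * S N)
  / (rpoch (1 + INR k) (r * S N) * rpoch (1 + INR (S k)) (r * S N)) * x ^ (r * S N).

Lemma Rabs_residue (s a x : R) (k : nat) :
  0 < x -> Rabs (residue s a x k) = residue_coef s a x k * Rabs (residue_tail s a x k).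
Proof.
  intros Hx. unfold residue, residue_coef, Rdiv.
  assert (H1 := rpoch_pos (1 / 2) (S k) ltac:(lra)).
  assert (H2 := rpoch_pos 1 (S k) ltac:(lra)).
  rewrite !Rabs_mult, Rabs_inv, Rabs_mult, Rabs_rpoch_neg.
  rewrite (Rabs_pos_eq (x ^ S k)) by (left; apply pow_lt; auto).
  rewrite (Rabs_pos_eq (rpoch 1 (S k))) by lra.
  f_equal. f_equal. f_equal. f_equal. apply Rabs_pos_eq.
  unfold Rdiv in H1. lra.
Qed.

Lemma residue_coef_step (a x : R) (N r k : nat) :
  residue_coef (INR (S N)) a x (k + r * S N) =
  residue_coef (INR (S N)) a x k * residue_coef_ratio (INR (S N)) a x N r k.
Proof.
  unfold residue_coef, residue_coef_ratio.
  assert (Hs : 0 < INR (S N)) by (apply lt_0_INR; lia).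
  replace (a - INR (k + r * S N) / INR (S N)) with (a - INR k / INR (S N) - INR r)
    by (rewrite plus_INR, mult_INR; field; lra).
  set (al := a - INR k / INR (S N)).
  replace (S (k + r * S N)) with (r + (S k + r * N))%nat at 1 by lia.
  replace (S (k + r * S N)) with (S k + r * S N)%nat by lia.
  rewrite (rpoch_add (al - INR r) r), (rpoch_add (al - INR r + INR r) (S k)).
  replace (al - INR r + INR r) with al by ring.
  rewrite (rpoch_add (1 / 2)), (rpoch_add 1 k), (rpoch_add 1 (S k)), pow_add, !Rabs_mult.
  unfold Rdiv. rewrite !Rinv_mult. ring.
Qed.

(** Each Pochhammer symbol of fixed length behaves like a power of its base, linear in j. Numerator
    and denominator both have degree 2 r s in j, so only the leading coefficients remain. *)
Lemma is_lim_seq_residue_coef_ratio (a x : R) (N r k1 : nat) :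
  (1 <= N)%nat -> (1 <= r)%nat ->
  is_lim_seq (fun j => residue_coef_ratio (INR (S N)) a x N r (k1 + j * (r * S N)))
    ((INR N ^ N * x ^ S N / INR (S N) ^ S N) ^ r).
Proof.
  intros HN Hr. set (R := (r * S N)%nat). set (s := INR (S N)).
  assert (Hs : 0 < s) by (apply lt_0_INR; lia).
  assert (Hr' : 0 < INR r) by (apply lt_0_INR; lia).
  assert (HN' : 0 < INR N) by (apply lt_0_INR; lia).
  assert (HR : INR R = INR r * s) by (unfold R, s; apply mult_INR).
  assert (HR0 : 0 < INR R) by (rewrite HR; nra).
  set (u1 := fun j : nat => Rabs (rpoch (a - INR k1 / s - INR r + (- INR r) * INR j) r / INR j ^ r)).
  set (u2 := fun j : nat => Rabs (rpoch (a - INR k1 / s + INR k1 + 1 + (INR r * INR N) * INR j) (r * N)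
                              / INR j ^ (r * N))).
  set (u3 := fun j : nat => rpoch (1 / 2 + INR k1 + 1 + INR R * INR j) R / INR j ^ R).
  set (u4 := fun j : nat => rpoch (1 + INR k1 + INR R * INR j) R / INR j ^ R).
  set (u5 := fun j : nat => rpoch (1 + INR k1 + 1 + INR R * INR j) R / INR j ^ R).
  assert (L1 : is_lim_seq u1 (INR r ^ r)).
  { assert (H := is_lim_seq_abs _ _ (is_lim_seq_rpoch (a - INR k1 / s - INR r) (- INR r) r)).
    simpl in H. rewrite <- RPow_abs, Rabs_Ropp, Rabs_pos_eq in H by lra. exact H. }
  assert (L2 : is_lim_seq u2 ((INR r * INR N) ^ (r * N))).
  { assert (H := is_lim_seq_abs _ _
      (is_lim_seq_rpoch (a - INR k1 / s + INR k1 + 1) (INR r * INR N) (r * N))).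
    simpl in H. rewrite Rabs_pos_eq in H by (apply pow_le; nra). exact H. }
  assert (L3 : is_lim_seq u3 (INR R ^ R)) by apply is_lim_seq_rpoch.
  assert (L4 : is_lim_seq u4 (INR R ^ R)) by apply is_lim_seq_rpoch.
  assert (L5 : is_lim_seq u5 (INR R ^ R)) by apply is_lim_seq_rpoch.
  assert (HRR : INR R ^ R <> 0) by (apply pow_nonzero; lra).
  assert (L : is_lim_seq (fun j => u1 j * u2 j * u3 j / (u4 j * u5 j) * x ^ R)
     (INR r ^ r * (INR r * INR N) ^ (r * N) * INR R ^ R / (INR R ^ R * INR R ^ R) * x ^ R)).
  { apply is_lim_seq_mult'; [|apply is_lim_seq_const].
    apply is_lim_seq_div'.
    - apply is_lim_seq_mult'; [|exact L3]. apply is_lim_seq_mult'; auto.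
    - apply is_lim_seq_mult'; auto.
    - apply Rmult_integral_contrapositive_currified; auto. }
  replace ((INR N ^ N * x ^ S N / s ^ S N) ^ r)
    with (INR r ^ r * (INR r * INR N) ^ (r * N) * INR R ^ R / (INR R ^ R * INR R ^ R) * x ^ R).
  - revert L. apply is_lim_seq_ext_loc. exists 1%nat. intros j Hj.
    assert (Hj' : 0 < INR j) by (apply lt_0_INR; lia).
    assert (Hk : INR (k1 + j * R) = INR k1 + INR j * INR R) by (now rewrite plus_INR, mult_INR).
    unfold residue_coef_ratio. fold R.
    replace (a - INR (k1 + j * R) / s - INR r) with (a - INR k1 / s - INR r + - INR r * INR j)
      by (rewrite Hk, HR; field; lra).
    replace (a - INR (k1 + j * R) / s + INR (S (k1 + j * R)))
      with (a - INR k1 / s + INR k1 + 1 + INR r * INR N * INR j).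
    2:{ rewrite S_INR, Hk, HR. unfold s. rewrite S_INR. field. generalize (pos_INR N). lra. }
    replace (1 / 2 + INR (S (k1 + j * R))) with (1 / 2 + INR k1 + 1 + INR R * INR j)
      by (rewrite S_INR, Hk; ring).
    replace (1 + INR (k1 + j * R)) with (1 + INR k1 + INR R * INR j) by (rewrite Hk; ring).
    replace (1 + INR (S (k1 + j * R))) with (1 + INR k1 + 1 + INR R * INR j)
      by (rewrite S_INR, Hk; ring).
    unfold u1, u2, u3, u4, u5.
    assert (Hp : forall n, 0 < INR j ^ n) by (intros; now apply pow_lt).
    rewrite !Rabs_div by (apply Rgt_not_eq, Hp).
    rewrite !(Rabs_pos_eq (INR j ^ _)) by (left; apply Hp).
    replace (INR j ^ R) with (INR j ^ r * INR j ^ (r * N))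
      by (rewrite <- pow_add; f_equal; unfold R; lia).
    assert (P4 : 0 < rpoch (1 + INR k1 + INR R * INR j) R)
      by (apply rpoch_pos; generalize (pos_INR k1); intros; nra).
    assert (P5 : 0 < rpoch (1 + INR k1 + 1 + INR R * INR j) R)
      by (apply rpoch_pos; generalize (pos_INR k1); intros; nra).
    assert (J1 := Hp r). assert (J2 := Hp (r * N)%nat).
    field. repeat split; lra.
  - rewrite HR.
    replace (INR r ^ r * (INR r * INR N) ^ (r * N) * (INR r * s) ^ R
              / ((INR r * s) ^ R * (INR r * s) ^ R) * x ^ R)
      with (INR r ^ r * (INR r * INR N) ^ (r * N) / (INR r * s) ^ R * x ^ R)
      by (rewrite HR in HRR; field; exact HRR).
    rewrite !Rpow_mult_distr.
    replace (INR r ^ R) with (INR r ^ r * INR r ^ (r * N))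
      by (rewrite <- pow_add; f_equal; unfold R; lia).
    unfold Rdiv. rewrite !Rpow_mult_distr, pow_inv.
    rewrite <- !pow_mult. unfold R.
    replace (S N * r)%nat with (r * S N)%nat by lia.
    replace (N * r)%nat with (r * N)%nat by lia.
    field. repeat split; apply pow_nonzero; lra.
Qed.

Lemma residue_tail_pos (a x : R) (N k : nat) :
  0 < a - INR k / INR (S N) + INR (S k) -> 0 < x < 1 ->
  1 < residue_tail (INR (S N)) a x k.
Proof.
  intros HA Hx. unfold residue_tail. assert (H := pos_INR (S k)).
  apply hseries_gt1; lra.
Qed.

(** The first parameter of the tail grows by r N with each j, so the comparing binomial series gain
    the factor (1-x)^(-r N). After removing it the tail is bounded above, and below up to the factor
    1/(j+1) that comes from the division by A - 1. *)
Lemma residue_tail_bounds (a x : R) (N r k1 : nat) :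
  (1 <= N)%nat -> (1 <= r)%nat -> 0 < x < 1 ->
  1 < a - INR k1 / INR (S N) + INR (S k1) ->
  exists c B, 0 < c /\ forall j,
    c <= residue_tail (INR (S N)) a x (k1 + j * (r * S N)) * (1 - x) ^ (j * (r * N)) * INR (S j) /\
    residue_tail (INR (S N)) a x (k1 + j * (r * S N)) * (1 - x) ^ (j * (r * N)) <= B.
Proof.
  intros HN Hr Hx HA0. set (A0 := a - INR k1 / INR (S N) + INR (S k1)) in *.
  assert (Hr' : 0 < INR r) by (apply lt_0_INR; lia).
  assert (HN' : 0 < INR N) by (apply lt_0_INR; lia).
  assert (HrN : 0 < INR r * INR N) by nra.
  assert (HbA : 1 < binom_series (A0 - 1) x) by (apply hseries_gt1; lra).
  exists ((binom_series (A0 - 1) x - 1) / (A0 + INR r * INR N)), (binom_series A0 x).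
  split; [apply Rdiv_lt_0_compat; lra|].
  intros j. set (n := (j * (r * N))%nat). set (k := (k1 + j * (r * S N))%nat).
  assert (Hn : INR n = INR j * (INR r * INR N)) by (unfold n; now rewrite !mult_INR).
  assert (HA : a - INR k / INR (S N) + INR (S k) = A0 + INR n).
  { rewrite Hn. unfold A0, k. rewrite !S_INR, plus_INR, !mult_INR, S_INR. field. lra. }
  assert (Hj := pos_INR j). assert (Hn0 := pos_INR n). assert (Hk0 := pos_INR (S k)).
  unfold residue_tail. rewrite HA.
  replace (1 / 2 + INR (S k)) with (1 + INR (S k) - 1 / 2) by field.
  destruct (hseries_half_bounds (A0 + INR n) (1 + INR (S k)) x ltac:(lra) ltac:(lra) Hx) as [H1 H2].
  set (T := hseries (A0 + INR n) (1 + INR (S k) - 1 / 2) 1 (1 + INR (S k)) x) in *.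
  replace (A0 + INR n - 1) with (A0 - 1 + INR n) in H1 by ring.
  rewrite binom_series_add in H1, H2 by auto.
  set (q := (1 - x) ^ n) in *.
  assert (Hq : 0 < q) by (apply pow_lt; lra).
  assert (Hq1 : q <= 1).
  { apply Rle_trans with (1 ^ n); [apply pow_incr; lra|rewrite pow1; lra]. }
  split.
  - set (b := binom_series (A0 - 1) x) in *.
    apply (Rmult_le_compat_r (q * INR (S j))) in H1; [|apply Rmult_le_pos; [lra|apply pos_INR]].
    rewrite Rmult_assoc. eapply Rle_trans; [|exact H1].
    replace ((b / q - 1) / (A0 - 1 + INR n) * (q * INR (S j)))
      with ((b - q) * (INR (S j) / (A0 - 1 + INR n))) by (field; lra).
    apply Rmult_le_compat; [lra| |lra|].
    + left. apply Rinv_0_lt_compat. lra.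
    + apply Rmult_le_reg_r with ((A0 - 1 + INR n) * (A0 + INR r * INR N));
        [apply Rmult_lt_0_compat; lra|].
      replace (/ (A0 + INR r * INR N) * ((A0 - 1 + INR n) * (A0 + INR r * INR N)))
        with (A0 - 1 + INR n) by (field; lra).
      replace (INR (S j) / (A0 - 1 + INR n) * ((A0 - 1 + INR n) * (A0 + INR r * INR N)))
        with (INR (S j) * (A0 + INR r * INR N)) by (field; lra).
      rewrite S_INR, Hn. nra.
  - apply (Rmult_le_compat_r q) in H2; [|lra].
    replace (binom_series A0 x / q * q) with (binom_series A0 x) in H2 by (field; lra). exact H2.
Qed.

Lemma pow_inj_pos (a b : R) (n : nat) : 0 < a -> 0 < b -> (1 <= n)%nat -> a ^ n = b ^ n -> a = b.
Proof.
  intros Ha Hb Hn E.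
  assert (Hlt : forall u v, 0 < u -> u < v -> u ^ n < v ^ n).
  { intros u v Hu Huv. destruct n as [|n]; [lia|]. clear E Hn.
    induction n as [|n IH]; [simpl; lra|].
    change (u * u ^ S n < v * v ^ S n).
    apply Rmult_gt_0_lt_compat; auto; [apply pow_lt|]; lra. }
  destruct (Rtotal_order a b) as [H|[H|H]]; auto.
  - specialize (Hlt a b Ha H). lra.
  - specialize (Hlt b a Hb H). lra.
Qed.

(** The ratio of |residues| over a step of r s in k is computed twice: the recurrence gives the
    limit 1, the explicit formula gives E^r for the coefficient times the ratio of the tails. Hence
    the tail ratio has a limit, which its polynomially tight bounds identify as (1-x)^(-r N). *)
Theorem critical_equation (p r a x : R) (N : nat) :
  0 < p -> 0 < x < 1 -> (1 <= N)%nat -> r / p = INR (S N) ->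
  problemI_solution p 0 r a (1 / 2) x ->
  INR N ^ N * x ^ S N = INR (S N) ^ S N * (1 - x) ^ N.
Proof.
  intros Hp Hx HN Hrp Hsol.
  assert (HN' : 1 <= INR N) by (apply (le_INR 1); lia).
  set (s := INR (S N)) in *.
  assert (Hs : s = INR N + 1) by (unfold s; apply S_INR).
  assert (Hr : r = s * p) by (rewrite <- Hrp; field; lra).
  assert (Hpr : 0 < p < r) by (rewrite Hr, Hs; nra).
  destruct (solution_recurrence p r a x Hsol) as (lam & us & vs & Hlam & Heq).
  assert (Hbal := shift_equation_balanced lam us vs p r a x Hlam Hpr Hx Heq).
  destruct (exists_Cmod_bound (us ++ vs)) as (B & HB & HBu).
  (* For k >= K the point -k/r - 1 lies beyond all zeros of U and V, and a - k/s + k + 1 > 1 because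
     k/s <= k/2. *)
  destruct (INR_unbounded (r * B + 2 * Rabs a + 2)) as [K HK].
  assert (Ha := Rabs_pos a).
  assert (HrB : 0 < r * B) by (apply Rmult_lt_0_compat; lra).
  assert (Hks : forall k, (K <= k)%nat -> INR k / s <= INR k / 2).
  { intros k Hk. apply Rmult_le_compat_l; [apply pos_INR|]. apply Rinv_le_contravar; lra. }
  assert (HA : forall k, (K <= k)%nat -> 1 < a - INR k / s + INR (S k)).
  { intros k Hk. specialize (Hks k Hk). apply le_INR in Hk. rewrite S_INR. split_Rabs; lra. }
  assert (Hw1 : forall k l, (K <= k)%nat -> (forall u, In u l -> In u (us ++ vs)) ->
             0 < absprod l (- INR k / r - 1)).
  { intros k l Hk Hl. apply absprod_pos. intros u Hu.
    apply Rlt_le_trans with B; [auto|]. apply le_INR in Hk.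
    assert (B < INR k / r).
    { apply Rmult_lt_reg_r with r; [lra|]. unfold Rdiv. rewrite Rmult_assoc, Rinv_l; lra. }
    replace (- INR k / r - 1) with (- (INR k / r + 1)) by (field; lra).
    rewrite Rabs_Ropp, Rabs_pos_eq; lra. }
  (* A residue this far out vanishes only if k/s - a is an integer. That cannot happen for two
     consecutive k, since 0 < 1/s < 1. *)
  assert (Hk1 : exists k1, (K <= k1)%nat /\ rpoch (a - INR k1 / s) (S k1) <> 0).
  { assert (Hz : forall k, rpoch (a - INR k / s) (S k) = 0 -> exists n : Z, INR k / s - a = IZR n).
    { intros k. assert (Hgen : forall y m, rpoch y m = 0 -> exists n : Z, - y = IZR n).
      { intros y m. induction m as [|m IH]; simpl; intros E; [lra|].
        apply Rmult_integral in E. destruct E as [E|E]; [auto|].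
        exists (Z.of_nat m). rewrite <- INR_IZR_INZ. lra. }
      intros E. destruct (Hgen _ _ E) as [n Hn]. exists n. lra. }
    destruct (Req_dec (rpoch (a - INR K / s) (S K)) 0) as [E1|E1]; [|exists K; auto].
    destruct (Req_dec (rpoch (a - INR (S K) / s) (S (S K))) 0) as [E2|E2]; [|exists (S K); auto].
    exfalso. apply Hz in E1, E2. destruct E1 as [n1 E1], E2 as [n2 E2].
    assert (E : / s = IZR (n2 - n1)).
    { rewrite minus_IZR, <- E1, <- E2, S_INR. field. lra. }
    assert (H1 : 0 < / s) by (apply Rinv_0_lt_compat; lra).
    assert (H2 : / s < 1) by (rewrite <- Rinv_1; apply Rinv_lt_contravar; lra).
    rewrite E in H1, H2. apply (lt_IZR 0) in H1. apply (lt_IZR _ 1) in H2. lia. }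
  destruct Hk1 as (k1 & HKk1 & Hk1).
  assert (Hres1 : residue s a x k1 <> 0).
  { apply Rabs_no_R0 in Hk1. intros E. apply (f_equal Rabs) in E.
    rewrite Rabs_residue, Rabs_R0 in E by lra.
    assert (Ht := residue_tail_pos a x N k1 ltac:(specialize (HA k1 HKk1); fold s; lra) Hx).
    fold s in Ht. rewrite (Rabs_pos_eq (residue_tail s a x k1)) in E by lra.
    apply Rmult_integral in E. destruct E as [E|E]; [|lra]. revert E.
    unfold residue_coef. assert (H1 := rpoch_pos 1 k1 Rlt_0_1).
    assert (H2 := rpoch_pos 1 (S k1) Rlt_0_1). assert (H3 := rpoch_pos (1 / 2) (S k1) ltac:(lra)).
    assert (H4 := pow_lt x (S k1) (proj1 Hx)).
    assert (H5 := Rabs_pos (rpoch (a - INR k1 / s) (S k1))).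
    apply Rgt_not_eq, Rmult_lt_0_compat; [|exact H4].
    apply Rdiv_lt_0_compat; apply Rmult_lt_0_compat; lra. }
  assert (Hrec := fun k => residue_recurrence lam us vs p r a x k Hp ltac:(lra) Hx Heq).
  rewrite Hrp in Hrec.
  assert (Hint : exists r' : nat, r = INR r').
  { destruct (Classical_Prop.classic (exists r' : nat, r = INR r')) as [H|H]; [exact H|exfalso].
    destruct (Hrec k1) as [_ H2].
    assert (E : absprod vs (- INR k1 / r - 1) * Rabs (residue s a x k1) = 0).
    { apply H2. intros r' E. apply H. now exists r'. }
    assert (Hv := Hw1 k1 vs HKk1 ltac:(intros; apply in_or_app; auto)).
    apply Rabs_pos_lt in Hres1. apply Rmult_integral in E. lra. }
  destruct Hint as [r' Hr'].
  assert (Hr1 : (1 <= r')%nat) by (destruct r'; [simpl in Hr'; lra|lia]).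
  set (b := fun i => Rabs (residue s a x (k1 + i * r'))).
  assert (Hbrec : forall i, absprod vs (- INR k1 / r - 1 + (-1) * INR i) * b i =
                       lam * absprod us (- INR k1 / r - 1 + (-1) * INR i) * b (S i)).
  { intros i. unfold b. destruct (Hrec (k1 + i * r')%nat) as [H _]. specialize (H r' Hr').
    replace (k1 + i * r' + r')%nat with (k1 + S i * r')%nat in H by lia.
    replace (- INR (k1 + i * r') / r - 1) with (- INR k1 / r - 1 + (-1) * INR i) in H; [exact H|].
    rewrite plus_INR, mult_INR, <- Hr'. field. lra. }
  assert (Hwi : forall i l, (forall u, In u l -> In u (us ++ vs)) ->
             0 < absprod l (- INR k1 / r - 1 + (-1) * INR i)).
  { intros i l Hl. assert (H := Hw1 (k1 + i * r')%nat l ltac:(lia) Hl).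
    replace (- INR (k1 + i * r') / r - 1) with (- INR k1 / r - 1 + (-1) * INR i) in H; [exact H|].
    rewrite plus_INR, mult_INR, <- Hr'. field. lra. }
  assert (HV := fun i => Hwi i vs ltac:(intros; apply in_or_app; auto)).
  assert (HU := fun i => Hwi i us ltac:(intros; apply in_or_app; auto)).
  (* One nonzero residue suffices: V does not vanish along the progression, so the recurrence
     carries nonvanishing forward. *)
  assert (Hb : forall i, 0 < b i).
  { induction i as [|i IH].
    - unfold b. simpl. rewrite Nat.add_0_r. now apply Rabs_pos_lt.
    - assert (H0 : 0 <= b (S i)) by apply Rabs_pos.
      destruct H0 as [H0|H0]; [exact H0|exfalso].
      specialize (Hbrec i). rewrite <- H0 in Hbrec. specialize (HV i). nra. }
  (* Successive residues belong to points moving left by 1, so their ratio is the inverse of the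
     shift ratio with [sg] = -1, whose limit was found to be 1 at the other end. *)
  assert (Hblim : is_lim_seq (fun i => b (S i) / b i) 1).
  { apply (is_lim_seq_ext (fun i => / shift_ratio lam us vs (- INR k1 / r - 1 + (-1) * INR i))).
    - intros i. unfold shift_ratio. specialize (HV i). specialize (HU i). specialize (Hbrec i).
      specialize (Hb i). set (U := absprod us _) in *. set (V := absprod vs _) in *.
      apply Rmult_eq_reg_r with (lam * U * b i); [|repeat apply Rmult_integral_contrapositive_currified; lra].
      transitivity (V * b i); [field; lra|]. rewrite Hbrec. field. lra.
    - replace (Finite 1) with (Rbar_inv 1) by (simpl; f_equal; field).
      apply is_lim_seq_inv; [|intros E; injection E; lra].
      rewrite <- Hbal. apply is_lim_seq_shift_ratio; auto. rewrite Rabs_left; lra. }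
  assert (Hbs := is_lim_seq_ratio_step b (S N) Hb Hblim).
  assert (Hbs' : is_lim_seq (fun j => b (S j * S N)%nat / b (j * S N)%nat) 1).
  { apply (is_lim_seq_ext (fun j => b (j * S N + S N)%nat / b (j * S N)%nat)).
    - intros j. do 2 f_equal. lia.
    - apply (is_lim_seq_subseq (fun i => b (i + S N)%nat / b i) 1 (fun j => (j * S N)%nat)); auto.
      apply eventually_subseq. intros n. lia. }
  set (cf := fun j => residue_coef s a x (k1 + j * (r' * S N))).
  set (tl := fun j => residue_tail s a x (k1 + j * (r' * S N))).
  set (t := fun j => tl j * (1 - x) ^ (j * (r' * N))).
  assert (Htl : forall j, 1 < tl j).
  { intros j. apply residue_tail_pos; auto. fold s.
    assert (H := HA (k1 + j * (r' * S N))%nat ltac:(lia)). lra. }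
  assert (Hbc : forall j, b (j * S N)%nat = cf j * tl j).
  { intros j. unfold b, cf, tl. replace (k1 + j * S N * r')%nat with (k1 + j * (r' * S N))%nat by lia.
    rewrite Rabs_residue by lra. f_equal. apply Rabs_pos_eq. generalize (Htl j). unfold tl. lra. }
  assert (Hcf : forall j, 0 < cf j).
  { intros j. generalize (Hb (j * S N)%nat) (Htl j). rewrite Hbc. intros. nra. }
  set (q := fun j => residue_coef_ratio s a x N r' (k1 + j * (r' * S N))).
  assert (Hcq : forall j, cf (S j) = cf j * q j).
  { intros j. unfold cf, q, s. rewrite <- residue_coef_step. f_equal. lia. }
  assert (Hq := is_lim_seq_residue_coef_ratio a x N r' k1 HN Hr1). fold s q in Hq.
  set (E := INR N ^ N * x ^ S N / s ^ S N) in *.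
  assert (HE : 0 < E).
  { unfold E. apply Rdiv_lt_0_compat; [apply Rmult_lt_0_compat|]; apply pow_lt; lra. }
  assert (Hq0 : forall j, q j <> 0).
  { intros j Ej. generalize (Hcf (S j)). rewrite Hcq, Ej. lra. }
  assert (Ht : forall j, 0 < t j).
  { intros j. apply Rmult_lt_0_compat; [generalize (Htl j); lra|apply pow_lt; lra]. }
  assert (Hlim : is_lim_seq (fun j => t (S j) / t j) ((1 - x) ^ (r' * N) / E ^ r')).
  { apply (is_lim_seq_ext (fun j => b (S j * S N)%nat / b (j * S N)%nat * ((1 - x) ^ (r' * N) / q j))).
    - intros j. rewrite !Hbc, Hcq. unfold t.
      replace (S j * (r' * N))%nat with (j * (r' * N) + r' * N)%nat by lia. rewrite pow_add.
      specialize (Hq0 j). generalize (Hcf j) (Htl j). intros.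
      assert ((1 - x) ^ (j * (r' * N)) <> 0) by (apply pow_nonzero; lra).
      field. repeat split; auto; lra.
    - rewrite <- (Rmult_1_l ((1 - x) ^ (r' * N) / E ^ r')).
      apply is_lim_seq_mult'; [exact Hbs'|].
      apply is_lim_seq_div'; [apply is_lim_seq_const|exact Hq|].
      apply pow_nonzero; lra. }
  destruct (residue_tail_bounds a x N r' k1 HN Hr1 Hx (HA k1 HKk1)) as (c & Bt & Hc & Hbd).
  (* A bounded positive [t] forces the limit of its ratios to be at most 1; t_j (j+1) has the same
     limit of ratios and is bounded below, which forces at least 1. *)
  assert (Hth : (1 - x) ^ (r' * N) / E ^ r' = 1).
  { assert (H1 := is_lim_seq_ratio_le1 t Bt _
        (fun j => conj (Ht j) (proj2 (Hbd j))) Hlim).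
    assert (Hlim2 : is_lim_seq (fun j => t (S j) * INR (S (S j)) / (t j * INR (S j)))
                      ((1 - x) ^ (r' * N) / E ^ r')).
    { apply (is_lim_seq_ext (fun j => t (S j) / t j * ((2 + INR j) / (1 + INR j)))).
      - intros j. rewrite !S_INR. generalize (Ht j) (pos_INR j). intros. field. lra.
      - rewrite <- (Rmult_1_r ((1 - x) ^ (r' * N) / E ^ r')).
        apply is_lim_seq_mult'; auto. apply is_lim_seq_affine_ratio. lra. }
    assert (H2 := is_lim_seq_ratio_ge1 (fun j => t j * INR (S j)) c _ Hc
        (fun j => proj1 (Hbd j)) Hlim2).
    simpl in H1, H2. lra. }
  assert (Hpow : ((1 - x) ^ N) ^ r' = E ^ r').
  { rewrite <- pow_mult. replace (N * r')%nat with (r' * N)%nat by lia.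
    assert (E ^ r' <> 0) by (apply pow_nonzero; lra).
    apply Rmult_eq_reg_r with (/ E ^ r'); [|now apply Rinv_neq_0_compat].
    rewrite Rinv_r by auto. exact Hth. }
  apply pow_inj_pos in Hpow; auto; [|apply pow_lt; lra].
  rewrite Hpow. unfold E. field. apply pow_nonzero; lra.
Qed.

(** * The degree bound *)

Lemma exists_least_nat (P : nat -> Prop) :
  (exists n, P n) -> exists n, P n /\ forall m, P m -> (n <= m)%nat.
Proof.
  intros [n Hn].
  destruct (dec_inh_nat_subset_has_unique_least_element P (fun m => Classical_Prop.classic (P m))
    (ex_intro _ n Hn)) as [m [Hm _]].
  now exists m.
Qed.

Lemma exists_prime_divisor (d : nat) :
  (1 < d)%nat -> exists q : nat, prime (Z.of_nat q) /\ (Z.of_nat q | Z.of_nat d)%Z.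
Proof.
  induction d as [d IH] using lt_wf_ind. intros Hd.
  destruct (prime_dec (Z.of_nat d)) as [Hp|Hp].
  - exists d. split; [exact Hp|apply Z.divide_refl].
  - destruct (not_prime_divide (Z.of_nat d) ltac:(lia) Hp) as [m [Hm1 Hm2]].
    destruct (IH (Z.to_nat m) ltac:(lia) ltac:(lia)) as [q [Hq1 Hq2]].
    exists q. split; [exact Hq1|]. rewrite Z2Nat.id in Hq2 by lia.
    now apply Z.divide_trans with m.
Qed.

Lemma exists_least_prime_factor (m : nat) : (1 < m)%nat -> exists ps, least_prime_factor ps m.
Proof.
  intros Hm.
  destruct (exists_least_nat (fun q => prime (Z.of_nat q) /\ (Z.of_nat q | Z.of_nat m)%Z)
    (exists_prime_divisor m Hm)) as [ps [[H1 H2] H3]].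
  exists ps. split; [exact H1|split; [exact H2|auto]].
Qed.

Lemma alg_degree_unique (x : R) (m n : nat) : alg_degree x m -> alg_degree x n -> m = n.
Proof.
  intros [[c [Hc Hcx]] Hm] [[c' [Hc' Hcx']] Hn].
  specialize (Hm n c' Hc' Hcx'). specialize (Hn m c Hc Hcx). lia.
Qed.

(** 5/2 is what 2N + 1 <= e N requires at N = 2, and 6 is the first exponent n for which (1 + 1/n)^n
    exceeds it. *)
Lemma exp1_lower : 5 / 2 < exp 1.
Proof.
  assert (H := exp_ineq1_le (/ 6)).
  assert (E : exp 1 = exp (/ 6) ^ 6).
  { simpl. rewrite Rmult_1_r, <- !exp_plus. f_equal. field. }
  rewrite E. apply Rlt_le_trans with ((7 / 6) ^ 6); [lra|].
  apply pow_incr. lra.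
Qed.

(** * Location of the critical root and the degree estimate *)

Section CriticalRoot.

Variables (N : nat) (x : R).
Hypothesis HN : (2 <= N)%nat.
Hypothesis Hx : 0 < x < 1.
Hypothesis Hcrit : INR N ^ N * x ^ S N = INR (S N) ^ S N * (1 - x) ^ N.

Let s := INR (S N).
Let z := INR N * x / (s * (1 - x)).

Let HN2 : 2 <= INR N. Proof. apply (le_INR 2); lia. Qed.
Let Hs : s = INR N + 1. Proof. apply S_INR. Qed.
Let Hz0 : 0 < z.
Proof.
  apply Rdiv_lt_0_compat; apply Rmult_lt_0_compat; lra.
Qed.

Lemma critical_linear : s * z + INR N = INR N / (1 - x).
Proof. unfold z. field. lra. Qed.

(** Both sides equal N/(1-x); on the left this is the critical equation. *)
Lemma critical_trinomial : z ^ S N = s * z + INR N.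
Proof.
  rewrite critical_linear. unfold z, Rdiv.
  rewrite !Rpow_mult_distr, pow_inv, Rpow_mult_distr.
  change (INR N ^ S N) with (INR N * INR N ^ N).
  rewrite (Rmult_assoc (INR N)), Hcrit. fold s.
  change ((1 - x) ^ S N) with ((1 - x) * (1 - x) ^ N).
  field. repeat split; try apply pow_nonzero; lra.
Qed.

(** The right side is s y + N at y = 1 + 2/s, so the trinomial is negative there. For s >= 4 the
    power is below e^2 <= 9 <= 2s + 1; for s = 3 it is 125/27 < 7. *)
Lemma critical_pow_lt : (1 + 2 / s) ^ S N < 2 * s + 1.
Proof.
  destruct (Nat.eq_dec N 2) as [E|E].
  - assert (Es : s = 3) by (rewrite Hs, E; simpl; lra).
    rewrite Es, E. simpl. lra.
  - assert (H3 : 3 <= INR N) by (generalize (le_INR 3 N ltac:(lia)); simpl; lra).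
    assert (H2 : exp 2 <= 9).
    { replace 2 with (1 + 1) by ring. rewrite exp_plus. generalize exp_le_3 (exp_pos 1). intros. nra. }
    assert (Hu : 0 < 2 / s) by (apply Rdiv_lt_0_compat; lra).
    apply Rlt_le_trans with (exp (2 / s) ^ S N).
    + assert (Hlt : forall a b n, 0 < a < b -> a ^ S n < b ^ S n).
      { intros a b n Hab. induction n as [|n IH]; [simpl; lra|].
        change (a * a ^ S n < b * b ^ S n).
        apply Rmult_gt_0_lt_compat; try lra. apply pow_lt; lra. }
      apply Hlt. split; [lra|]. apply exp_ineq1. lra.
    + rewrite <- Rpower_pow by apply exp_pos. unfold Rpower. rewrite ln_exp.
      fold s. replace (s * (2 / s)) with 2 by (field; lra). lra.
Qed.

(** At z the increasing y^N meets the decreasing s + N/y; at 1 + 2/s it is still below, so z lies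
    further right. *)
Lemma critical_root_gt : 1 + 2 / s < z.
Proof.
  generalize critical_trinomial critical_pow_lt; intros H2 H3.
  set (y := 1 + 2 / s) in *.
  assert (Hy : 0 < y) by (unfold y; assert (0 < 2 / s) by (apply Rdiv_lt_0_compat; lra); lra).
  assert (Hsy : s * y = s + 2) by (unfold y; field; lra).
  destruct (Rlt_le_dec y z) as [Hlt|Hle]; [exact Hlt|exfalso].
  assert (Hpow : z ^ N <= y ^ N) by (apply pow_incr; lra).
  assert (HpN : 0 < z ^ N) by now apply pow_lt.
  simpl in H2, H3.
  assert (A1 : y * z ^ N <= y * y ^ N) by (apply Rmult_le_compat_l; lra).
  assert (A2 : y * (z * z ^ N) < z * (s * y + INR N)).
  { replace (y * (z * z ^ N)) with (z * (y * z ^ N)) by ring.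
    apply Rmult_lt_compat_l; lra. }
  rewrite H2 in A2. nra.
Qed.

(** From z > 1 + 2/s one gets z^s = s z + N > 2s + 1 >= 7 and s/z < s^2/(s+2) = s - 2 + 4/(s+2) <= s
    - 2 + 4/5. As 1/7 + 4/5 < 1, the sum stays below s - 1. *)
Lemma critical_root_inv : (/ z) ^ S N + s * / z < INR N.
Proof.
  generalize critical_trinomial critical_root_gt; intros H2 H3.
  assert (Hsz : s + 2 < s * z).
  { replace (s + 2) with (s * (1 + 2 / s)) by (field; lra). apply Rmult_lt_compat_l; lra. }
  assert (B1 : (/ z) ^ S N < / 7).
  { rewrite pow_inv. apply Rinv_lt_contravar; [|lra].
    apply Rmult_lt_0_compat; [lra|]. rewrite H2. lra. }
  assert (B2 : s * / z < s - 2 + 4 / 5).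
  { apply Rmult_lt_reg_r with z; [lra|]. rewrite Rmult_assoc, Rinv_l by lra. nra. }
  lra.
Qed.

(** Dividing the trinomial equation by z > 1 gives z^N = s + N/z < 2N + 1 <= e N; the claim is its
    logarithm. *)
Lemma critical_root_ln : INR N * ln z < 1 + ln (INR N).
Proof.
  generalize critical_trinomial critical_root_gt; intros H2 H3.
  assert (Hu : 0 < 2 / s) by (apply Rdiv_lt_0_compat; lra).
  rewrite <- ln_pow by lra.
  rewrite <- (ln_exp 1), <- ln_mult by (try apply exp_pos; lra).
  apply ln_increasing; [apply pow_lt; lra|].
  assert (He := exp1_lower).
  apply Rlt_le_trans with (s + INR N); [|nra].
  apply Rmult_lt_reg_l with z; [lra|]. change (z * z ^ N) with (z ^ S N). nra.
Qed.

Lemma critical_degree_bound (ps : nat) :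
  least_prime_factor ps N -> exists n : nat, alg_degree x n /\ delta ps (S N) < INR n.
Proof.
  intros (Hp1 & Hp2 & Hp3). assert (Hz1 := critical_root_gt).
  assert (Hu : 0 < 2 / s) by (apply Rdiv_lt_0_compat; lra).
  destruct (exists_least_nat (fun n => exists c : nat -> Z, c n <> 0%Z /\ poly_eval c n x = 0)
    (TrinomialRoots.critical_root_algebraic N x Hcrit)) as [n [[c [Hc Hcx]] Hmin]].
  exists n. split.
  { split; [now exists c|]. intros m c' Hc' Hcx'. apply Hmin. now exists c'. }
  assert (Hxz : x * (INR N + s * z) = s * z).
  { rewrite (Rplus_comm (INR N)), critical_linear. unfold z. field. lra. }
  assert (Hz2 : 1 < z) by lra.
  assert (HN0 : ssrnat.leq 1 N = true) by (apply (ssrbool.introT ssrnat.leP); lia).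
  destruct (TrinomialRoots.degree_root_bound N n x z c HN0 Hz2
    critical_trinomial critical_root_inv Hxz Hc Hcx) as (d & e & [Hde Hd Hdz]).
  assert (Hd1 : (1 < d)%nat) by (destruct d as [|[|d]]; [discriminate|discriminate|lia]).
  assert (Hps : (ps <= d)%nat).
  { destruct (exists_prime_divisor d Hd1) as [q [Hq1 Hq2]].
    assert (Hqd : (q <= d)%nat) by (apply Z.divide_pos_le in Hq2; lia).
    assert (ps <= q)%nat; [|lia]. apply Hp3; auto.
    apply Z.divide_trans with (Z.of_nat d); auto.
    rewrite Hde, Nat2Z.inj_mul. apply Z.divide_factor_l. }
  assert (Hps0 : (1 < ps)%nat) by (apply prime_ge_2 in Hp1; lia).
  (* A degree 0 would force d <= 1. Positivity of n makes the final inequality strict, through N ln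
     z < 1 + ln N. *)
  assert (Hn : (0 < n)%nat).
  { destruct n; [|lia]. simpl in Hdz. apply (INR_le d 1) in Hdz. lia. }
  assert (Hln : ln (INR ps) <= INR n * ln z).
  { rewrite <- ln_pow by lra.
    assert (H3 : 0 < INR ps) by (apply lt_0_INR; lia).
    apply Rcomplements.ln_le; auto.
    apply Rle_trans with (INR d); [apply le_INR; lia|exact Hdz]. }
  assert (HlnN : 0 <= ln (INR N)) by (rewrite <- ln_1; apply Rcomplements.ln_le; lra).
  unfold delta. replace (S N - 1)%nat with N by lia.
  assert (Hlt := critical_root_ln).
  assert (Hn' : 0 < INR n) by now apply lt_0_INR.
  apply Rmult_lt_reg_r with (1 + ln (INR N)); [lra|].
  unfold Rdiv. rewrite Rmult_assoc, Rinv_l, Rmult_1_r by lra.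
  apply Rle_lt_trans with (INR n * ln z * INR N); [apply Rmult_le_compat_r; lra|].
  rewrite Rmult_assoc. apply Rmult_lt_compat_l; lra.
Qed.

End CriticalRoot.

(** * The quadratic case and the finiteness of s *)

Lemma square_eq_double_square (n : nat) :
  forall a b : Z, (Z.abs b < Z.of_nat n)%Z -> (a * a = 2 * (b * b))%Z -> b = 0%Z.
Proof.
  induction n as [|n IH]; intros a b Hb E; [lia|].
  (* Infinite descent: a and then b are even, and their halves satisfy the same equation. The bound
     n on |b| serves as the measure. *)
  assert (Hev : forall u v, (u * u = 2 * v)%Z -> exists w, u = (2 * w)%Z).
  { intros u v Huv. destruct (Z.Even_or_Odd u) as [[w Hw]|[w Hw]]; [now exists w|].
    exfalso. subst u. ring_simplify in Huv. lia. }
  destruct (Hev a _ E) as [a' ->].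
  destruct (Hev b (a' * a')%Z) as [b' ->]; [lia|].
  destruct (Z.eq_dec b' 0) as [->|Hb']; [reflexivity|].
  assert (b' = 0)%Z; [|lia].
  apply (IH a'); lia.
Qed.

Lemma critical_degree_two (x : R) : 0 < x < 1 -> x ^ 2 = 4 * (1 - x) -> alg_degree x 2.
Proof.
  intros Hx E. split.
  - exists (fun k => match k with O => (-4)%Z | S O => 4%Z | _ => 1%Z end). split; [discriminate|].
    unfold poly_eval; simpl. simpl in E. lra.
  - intros m c Hc Hcx. destruct m as [|[|m]]; [| |lia]; exfalso; unfold poly_eval in Hcx; simpl in Hcx.
    + apply Hc. apply eq_IZR. lra.
    + set (P := c 0%nat) in *. set (Q := c 1%nat) in *.
      assert (Hlin : IZR P = - (IZR Q * x)) by lra.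
      (* The equation x^2 + 4x - 4 = 0 reads (2+x)^2 = 8. A linear relation P + Q x = 0 gives 2Q - P
         = Q (2+x), whose square is 2 (2Q)^2. *)
      assert (EZ : ((2 * Q - P) * (2 * Q - P) = 2 * ((2 * Q) * (2 * Q)))%Z).
      { apply eq_IZR. rewrite !mult_IZR, !minus_IZR, !mult_IZR, Hlin. simpl in E.
        replace ((2 * IZR Q - - (IZR Q * x)) * (2 * IZR Q - - (IZR Q * x)))
          with (IZR Q * IZR Q * (4 + 4 * x + x * (x * 1))) by ring.
        rewrite E. ring. }
      apply square_eq_double_square with (n := S (Z.abs_nat (2 * Q))) in EZ; [|lia].
      apply Hc. lia.
Qed.

(** With M = s - 1, the estimates ln ps >= 1/2 and 1 + ln M <= 2 sqrt M give delta >= (sqrt M)/4,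
    which explains 16 D^2. The added 3 keeps ln M nonnegative even for D = 0. *)
Lemma delta_lower (ps s D : nat) :
  (2 <= ps)%nat -> (16 * D * D + 3 <= s - 1)%nat -> INR D <= delta ps s.
Proof.
  intros Hps Hs. unfold delta. set (M := INR (s - 1)).
  assert (HM : 16 * INR D * INR D + 3 <= M).
  { apply le_INR in Hs. rewrite plus_INR, !mult_INR, (INR_IZR_INZ 16), (INR_IZR_INZ 3) in Hs.
    simpl Z.of_nat in Hs. exact Hs. }
  assert (HD := pos_INR D).
  assert (HM0 : 3 <= M) by nra.
  set (t := sqrt M). assert (Ht : t * t = M) by (apply sqrt_sqrt; lra).
  assert (Ht0 : 0 < t) by (apply sqrt_lt_R0; lra).
  assert (HtD : 4 * INR D <= t).
  { apply Rsqr_incr_0; unfold Rsqr; lra. }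
  assert (Hln : ln M <= 2 * (t - 1)).
  { rewrite <- Ht, ln_mult by auto.
    assert (H := exp_ineq1_le (ln t)). rewrite exp_ln in H by auto. lra. }
  assert (HlnM : 0 <= ln M) by (rewrite <- ln_1; apply Rcomplements.ln_le; lra).
  assert (Hlnps : / 2 <= ln (INR ps)).
  { apply Rle_trans with (ln 2); [left; apply ln_lt_2|].
    apply Rcomplements.ln_le; [lra|]. apply (le_INR 2); lia. }
  apply Rmult_le_reg_r with (1 + ln M); [lra|].
  unfold Rdiv. rewrite Rmult_assoc, Rinv_l, Rmult_1_r by lra.
  apply Rle_trans with (/ 2 * M); [|apply Rmult_le_compat_r; lra].
  apply Rle_trans with (INR D * (2 * t)); [apply Rmult_le_compat_l; lra|].
  rewrite <- Ht. nra.
Qed.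

Theorem theorem2p3 :
  (forall p r a x : R,
     in_I p 0 r a (1/2) x ->
     problemI_solution p 0 r a (1/2) x ->
     ~ elementary p 0 r a (1/2) x ->
     (r / p = 2 -> alg_degree x 2) /\
     (forall s : nat, r / p = INR s -> (3 <= s)%nat ->
        forall ps : nat, least_prime_factor ps (s - 1) ->
        exists n : nat, alg_degree x n /\ delta ps s < INR n)) /\
  (forall D : nat, exists S : nat,
     forall p r a x : R,
       in_I p 0 r a (1/2) x ->
       problemI_solution p 0 r a (1/2) x ->
       ~ elementary p 0 r a (1/2) x ->
       forall n : nat, alg_degree x n -> (n <= D)%nat ->
       forall s : nat, r / p = INR s -> (s <= S)%nat).
Proof.
  assert (Hbound : forall p r a x : R,
     in_I p 0 r a (1/2) x -> problemI_solution p 0 r a (1/2) x ->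
     forall s : nat, r / p = INR s -> (3 <= s)%nat ->
     forall ps : nat, least_prime_factor ps (s - 1) ->
     exists n : nat, alg_degree x n /\ delta ps s < INR n).
  { intros p r a x (_ & Hp & Hpr & Hx0 & Hx1) Hsol s Hs Hs3 ps Hps.
    destruct s as [|N]; [lia|]. replace (S N - 1)%nat with N in Hps by lia.
    apply critical_degree_bound; auto; [lia|].
    apply (critical_equation p r a x N); auto; lia. }
  split.
  - intros p r a x HI Hsol _. split; [|exact (Hbound p r a x HI Hsol)].
    intros Hrp. destruct HI as (_ & Hp & Hpr & Hx0 & Hx1).
    apply critical_degree_two; auto.
    assert (E := critical_equation p r a x 1 Hp (conj Hx0 Hx1) ltac:(lia)
                   ltac:(rewrite Hrp; simpl; ring) Hsol).
    simpl in E. simpl. lra.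
  - intros D. exists (16 * D * D + 3)%nat. intros p r a x HI Hsol _ n Hn HnD s Hs.
    destruct (le_lt_dec s (16 * D * D + 3)) as [H|H]; [exact H|exfalso].
    destruct (exists_least_prime_factor (s - 1) ltac:(lia)) as [ps Hps].
    destruct (Hbound p r a x HI Hsol s Hs ltac:(lia) ps Hps) as [n' [Hn' Hd]].
    rewrite (alg_degree_unique x n' n Hn' Hn) in Hd.
    assert (Hps2 : (2 <= ps)%nat) by (destruct Hps as [Hp _]; apply prime_ge_2 in Hp; lia).
    assert (Hlow := delta_lower ps s D Hps2 ltac:(lia)).
    apply le_INR in HnD. lra.
Qed.
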